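(* Let $\kappa$ be a singular (uncountable) cardinal with $2^{<\kappa}=\kappa$, and let $X$ be a nonempty regular Hausdorff space of weight at most $\kappa$ such that every open subset of $X$ is a union of at most $\operatorname{cof}(\kappa)$-many closed sets (i.e. $\kappa\text{-}\boldsymbol{\Sigma}^0_1(X)\subseteq\operatorname{cof}(\kappa)^+\text{-}\boldsymbol{\Sigma}^0_2(X)$). Let $\alpha<\kappa^+$ be such that $1+\alpha<\operatorname{ord}_\kappa(X)$. (1) If $\alpha$ is even, then $\kappa\text{-}\boldsymbol{\Delta}^0_{1+\alpha}(X)\subsetneq\kappa\text{-}\boldsymbol{\Sigma}^0_{1+\alpha}(X)$ (equivalently, $\kappa\text{-}\boldsymbol{\Delta}^0_{1+\alpha}(X)\subsetneq\kappa\text{-}\boldsymbol{\Pi}^0_{1+\alpha}(X)$). (2) $\bigcup_{\beta<\alpha}\left(\kappa\text{-}\boldsymbol{\Sigma}^0_{1+\beta}(X)\cup\kappa\text{-}\boldsymbol{\Pi}^0_{1+\beta}(X)\right)\subsetneq\kappa\text{-}\boldsymbol{\Delta}^0_{1+\alpha}(X)$.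
   Context: For a topological space $X$ and an ordinal $\gamma>\omega$, define by recursion on ordinals $\alpha\ge 1$: $\gamma\text{-}\boldsymbol{\Sigma}^0_1(X)$ is the family of open sets; for $\alpha>1$, $\gamma\text{-}\boldsymbol{\Sigma}^0_\alpha(X)$ is the family of all unions $\bigcup_{\xi<\delta}A_\xi$ with $\delta<\gamma$ and each $A_\xi\in\bigcup_{1\le\beta<\alpha}\gamma\text{-}\boldsymbol{\Pi}^0_\beta(X)$; $\gamma\text{-}\boldsymbol{\Pi}^0_\alpha(X)$ is the family of complements of sets in $\gamma\text{-}\boldsymbol{\Sigma}^0_\alpha(X)$; $\gamma\text{-}\boldsymbol{\Delta}^0_\alpha(X)=\gamma\text{-}\boldsymbol{\Sigma}^0_\alpha(X)\cap\gamma\text{-}\boldsymbol{\Pi}^0_\alpha(X)$. $\gamma\text{-}\mathbf{Bor}(X)$ is the smallest family of subsets of $X$ containing the open sets and closed under complements and well-ordered unions of length less than $\gamma$. The order is $\operatorname{ord}_\gamma(X)=\min\{\alpha\in\mathrm{Ord}\mid\gamma\text{-}\boldsymbol{\Sigma}^0_\alpha(X)=\gamma\text{-}\mathbf{Bor}(X)\}$. Every ordinal $\alpha$ is written uniquely as $\alpha=\lambda+n$ with $n<\omega$ and $\lambda=0$ or $\lambda$ limit; $\alpha$ is even (odd) if $n$ is even (odd). *)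

(* Defs.v *)
From mathcomp Require Import all_boot.
From mathcomp Require Import boolp classical_sets functions cardinality wochoice.
From mathcomp Require Import topology.

Set Implicit Arguments.
Unset Strict Implicit.
Unset Printing Implicit Defensive.

Local Open Scope classical_set_scope.
Local Open Scope card_scope.

(* Ordinals are represented by well-ordered types, taken up to order
   isomorphism ([ord_iso]). *)
Record Ord := MkOrd {
  ord_sort :> Type;
  ole : rel ord_sort;
  ole_wo : well_order ole }.
Arguments ole {o} x y.

Declare Scope ord_scope.
Delimit Scope ord_scope with Ord.
Bind Scope ord_scope with Ord.

(* well-orders are total, so the strict order is the negated converse *)
Definition olt (a : Ord) (x y : a) : Prop := ~~ ole y x.

Definition ord_iso (a b : Ord) : Prop :=
  exists2 f : a -> b, {mono f : x y / ole x y} & bijective f.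

(* [a < b]: [a] is isomorphic to a proper initial segment of [b] *)
Definition ord_lt (a b : Ord) : Prop :=
  exists (z : b) (f : a -> b),
    {mono f : x y / ole x y} /\ range f = [set y | olt y z].

Definition ord_le (a b : Ord) : Prop := ord_lt a b \/ ord_iso a b.

Notation "a < b" := (ord_lt a b) : ord_scope.
Notation "a <= b" := (ord_le a b) : ord_scope.

(* The carrier is not ['I_n]: that would identify the universe of carriers with
   the one of [predArgType] and of [set], and exclude the type [set Ord]. *)
Definition nat_ole (n : nat) (i j : {i : nat | (i < n)%N}) : bool :=
  (sval i <= sval j)%N.

Lemma nat_ole_wo n : well_order (@nat_ole n).
Proof.
apply: antisymmetric_well_order => [[i ltin] [j ltjn] ij|A [[i ltin] iA]].
  have {ij} /= eij := anti_leq ij.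
  by case: _ / eij ltjn => ltjn; rewrite (bool_irrelevance ltin ltjn).
have exA : exists i, `[< exists ltin : (i < n)%N, exist _ i ltin \in A >].
  by exists i; apply/asboolP; exists ltin.
case: (ex_minnP exA) => m /asboolP[ltmn mA] mmin; exists (exist _ m ltmn).
by split=> // -[j ltjn] jA; apply: mmin; apply/asboolP; exists ltjn.
Qed.

Definition ord_nat (n : nat) : Ord := MkOrd (@nat_ole_wo n).

Definition sum_ole (a b : Ord) (u v : a + b) : bool :=
  match u, v with
  | inl x, inl y => ole x y
  | inl _, inr _ => true
  | inr _, inl _ => false
  | inr x, inr y => ole x y
  end.

Lemma ole_anti (a : Ord) : antisymmetric (@ole a).
Proof.
move=> x y /andP[xy yx].
have xx (z : a) : ole z z.
  have [|w [[/asboolP-> wz] _]] := @ole_wo a [pred t | `[< t = z >]].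
    by exists z; apply/asboolP.
  by apply: wz; apply/asboolP.
pose A : {pred a} := [pred t | `[< t = x \/ t = y >]].
have [|w [_ wu]] := @ole_wo a A; first by exists x; apply/asboolP; left.
rewrite -(wu x) ?(wu y) //; split; do ?[by apply/asboolP; auto];
  by move=> t /asboolP[]->.
Qed.

Lemma sum_ole_wo (a b : Ord) : well_order (@sum_ole a b).
Proof.
apply: antisymmetric_well_order => [[x|x] [y|y] //= xy|A].
- by rewrite (ole_anti xy).
- by rewrite (ole_anti xy).
have [[x xA] _|nA [[x xA|x xA]]] := pselect (exists x, inl x \in A).
- have [|m [[mA mmin] _]] := @ole_wo a [pred x | inl x \in A]; first by exists x.
  by exists (inl m); split=> // -[y yA|y yA] //=; apply: mmin.
- by exfalso; apply: nA; exists x.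
have [|m [[mA mmin] _]] := @ole_wo b [pred x | inr x \in A]; first by exists x.
exists (inr m); split=> // -[y yA|y yA] /=; last exact: mmin.
by exfalso; apply: nA; exists y.
Qed.

Definition ord_add (a b : Ord) : Ord := MkOrd (@sum_ole_wo a b).

Notation "a + b" := (ord_add a b) : ord_scope.

Definition ord_limit (l : Ord) : Prop :=
  (ord_nat 0 < l)%Ord /\ forall b : Ord, (b < l)%Ord -> (b + ord_nat 1 < l)%Ord.

Definition ord_even (a : Ord) : Prop :=
  exists (l : Ord) (n : nat),
    [/\ ord_iso l (ord_nat 0) \/ ord_limit l,
        ~~ odd n & ord_iso a (l + ord_nat n)%Ord].

(* A representative of the least ordinal satisfying [P], for nonempty [P]; for
   empty [P] it is the junk value 0. *)
Definition ord_min (P : Ord -> Prop) : Ord :=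
  if pselect (exists a, P a /\ forall b, P b -> (a <= b)%Ord) is left ex
  then sval (cid ex) else ord_nat 0.

Definition is_cardinal (k : Ord) : Prop :=
  forall a : Ord, (a < k)%Ord -> ~ ([set: a] #= [set: k]).

Definition card_succ (k : Ord) : Ord :=
  ord_min (fun m => is_cardinal m /\ (k < m)%Ord).

Definition cof (k : Ord) : Ord :=
  ord_min (fun d =>
    exists f : d -> k, forall x : k, exists i : d, ole x (f i)).

Definition uncountable_singular (k : Ord) : Prop :=
  [/\ is_cardinal k, ~ countable [set: k] & (cof k < k)%Ord].

(* The binary sequences of length less than [k]: the ordinals below [k] are the
   elements of [k], each identified with the set of its predecessors. *)
Definition binseq_lt (k : Ord) : Type :=
  {i : k & {j : k | olt j i} -> bool}.

(* 2^{<k} = k, where 2^{<k} is the cardinality of the set of binary sequences of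
   length less than [k]; for infinite [k] it is also the supremum of the
   cardinals 2^m with m < k. *)
Definition two_pow_lt_eq (k : Ord) : Prop := [set: binseq_lt k] #= [set: k].

Definition weight_le (X : topologicalType) (k : Ord) : Prop :=
  exists2 B : set (set X), basis B & B #<= [set: k].

(* [kSigma g X a] is g-Sigma^0_a(X). The recursion on the ordinal index is
   rendered by an inductive predicate, which is empty at index 0. The premises
   on [~` A i] say that [A i] is in g-Pi^0_(b i)(X). *)
Inductive kSigma (g : Ord) (X : topologicalType) : Ord -> set (set X) :=
| kSigma_open (a : Ord) (U : set X) :
    ord_iso a (ord_nat 1) -> open U -> kSigma g a U
| kSigma_bigcup (a d : Ord) (b : d -> Ord) (A : d -> set X) :
    (ord_nat 1 < a)%Ord -> (d < g)%Ord ->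
    (forall i, (ord_nat 1 <= b i)%Ord) ->
    (forall i, (b i < a)%Ord) ->
    (forall i, kSigma g (b i) (~` A i)) ->
    kSigma g a (\bigcup_i A i).
Arguments kSigma g X a A : clear implicits.

Definition kPi (g : Ord) (X : topologicalType) (a : Ord) : set (set X) :=
  [set A | kSigma g X a (~` A)].
Arguments kPi g X a A : clear implicits.

Definition kDelta (g : Ord) (X : topologicalType) (a : Ord) : set (set X) :=
  kSigma g X a `&` kPi g X a.
Arguments kDelta g X a A : clear implicits.

Definition kBor (g : Ord) (X : topologicalType) : set (set X) :=
  smallest [set F : set (set X) |
      (forall A, F A -> F (~` A)) /\
      (forall (d : Ord) (A : d -> set X),
          (d < g)%Ord -> (forall i, F (A i)) -> F (\bigcup_i A i))]
    open.
Arguments kBor g X A : clear implicits.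

Definition kord (g : Ord) (X : topologicalType) : Ord :=
  ord_min (fun a => (ord_nat 1 <= a)%Ord /\ kSigma g X a = kBor g X).
Arguments kord g X : clear implicits.

(* Main.v *)
Require Import Defs.
From mathcomp Require Import all_boot.
From mathcomp Require Import boolp classical_sets functions cardinality wochoice.
From mathcomp Require Import topology.

Set Implicit Arguments.
Unset Strict Implicit.
Unset Printing Implicit Defensive.

Local Open Scope classical_set_scope.
Local Open Scope card_scope.

(** Write [S c] and [P c] for the classes of index [1 + c] of the statement. A
   singular [k] with [2 ^ {<k} = k] is a strong limit ([small_powerset]), so
   that indices of size less than [k] are closed under sums, products and
   powers; call such a size small. On the other hand a union of [k] sets is a
   small union of small unions. These two facts split the levels in two kinds.

   At an even level [c], the class [S c] is closed under small unions, and there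
   is a small [V] such that every set of [S c] is a union of [V] sets of [P c]
   (at level [0] this is the hypothesis on open sets). Distributing a small
   intersection of unions of [V] sets then gives
   [S (c + 1) = P (c + 1) = small unions of P c], and [S (c + 2)] consists of the
   unions of at most [k] sets of [P c], so that [c + 2] is even again; limit levels below
   [k^+] are even because they have small cofinality ([even_level_limit]).

   A class [S c] closed under complements and small unions is the whole Borel
   class, which is excluded for [c <= a]. At an even level [a] this forbids
   [S a = P a], which is the first part. In the second part the inclusion is
   routine, and equality is refuted as follows. If [a = c + 1] with [c] even,
   then [S a] would be the union of [S c] and [P c], hence closed under small
   unions. If [a = c + 2] with [c] even or if [a] is a limit, the sets of level
   below [a] would form an algebra [B] that contains every set which is,
   together with its complement, a small union of members of [B]; moreover [B]
   is an increasing union of stages: the unions of a given number of sets of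
   [P c], respectively the levels below [a]. Each stage is carried into some
   other stage by complements and by small unions of a given size.

   The main point is that such an increasing union is stationary
   ([exhaustion_stationary]), so that [B] is one of its stages; being closed
   under the Borel operations, it is then the Borel class, which is
   excluded. To see it, call a set tame if all the members of [B] below
   it appear at one stage, and wild otherwise. There are no cofinally many
   disjoint wild sets in [B] whose union has its complement in [B]: a diagonal
   choice of subsets would give a member of [B] that appears at no stage
   ([no_wild_family]). As every cofinal family can be split in cofinally many
   cofinal subfamilies ([cofinal_split]), it follows that a small disjoint union
   of tame sets is tame. So the points with a tame neighbourhood, relative to a
   wild set, form a tame set, because the weight is at most [k]; hence there are
   two points without one, which have disjoint neighbourhoods, and every wild
   set is cut by an open set in two wild sets ([wild_split]). Iterating this
   along a small ordinal that is cofinal in the stages cuts the space in a small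
   number of cells. They cannot all be tame if the space is wild; along the way
   to a wild cell, cofinally many disjoint wild sets are split off, against
   [no_wild_family]. *)


(** * Comparing cardinalities *)

Lemma sval_inj T (A : T -> Prop) : injective (@sval T A).
Proof. by move=> [x Ax] [y Ay] /= exy; exact/eq_exist. Qed.

Definition emb (T U : Type) : Prop := exists f : T -> U, injective f.

Lemma emb_refl T : emb T T.
Proof. by exists id. Qed.

Lemma emb_trans T U V : emb T U -> emb U V -> emb T V.
Proof. by move=> [f fi] [g gi]; exists (g \o f); apply: inj_comp. Qed.

Lemma emb_prod T T' U U' : emb T T' -> emb U U' -> emb (T * U) (T' * U').
Proof.
move=> [f fi] [g gi]; exists (fun p => (f p.1, g p.2)).
by move=> [x y] [x' y'] /= [/fi-> /gi->].
Qed.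

Lemma emb_card_le T U (A : set T) (B : set U) :
  A #<= B -> emb {x | A x} {y | B y}.
Proof.
move=> /card_leP[f].
exists (fun x => exist _ (\val (f (SigSub (mem_set (svalP x))))) (set_valP _)).
move=> [x Ax] [y Ay] /= [] /val_inj /(inj (mem_set Logic.I) (mem_set Logic.I)) [exy].
exact/eq_exist.
Qed.

Lemma emb_sub T (A : set T) : emb {x | A x} T.
Proof. by exists sval; apply: sval_inj. Qed.

Lemma emb_setT T U : [set: T] #<= [set: U] -> emb T U.
Proof.
move=> /emb_card_le TU; apply: emb_trans (emb_sub setT).
by apply: emb_trans TU; exists (fun x => exist _ x I) => x y [].
Qed.

Lemma card_leT_emb T U : emb T U -> [set: T] #<= [set: U].
Proof.
move=> [f fi]; apply: card_le_trans (card_leT (range f)).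
by have := @inj_card_eq _ _ setT f (in2W fi); rewrite card_eq_le => /andP[].
Qed.

Lemma emb_surj T U (y0 : T) : emb T U -> exists f : U -> T, forall y, exists x, f x = y.
Proof.
move=> [f fi].
have /choice[g gP] (y : U) : exists x, (exists x', f x' = y) -> f x = y.
  by have [[x <-]|ny] := pselect (exists x', f x' = y); [exists x|exists y0].
by exists g => x; exists (f x); apply/fi/gP; exists x.
Qed.

(** A maximal set of choice functions that pairwise differ everywhere
   projects onto one of the factors, by maximality; that factor then injects
   in all the others. *)
Lemma emb_least (I : Type) (A : I -> Type) :
  inhabited I -> exists i, forall j, emb (A i) (A j).
Proof.
move=> [i0].
pose P (C : set (forall i, A i)) :=
  forall f g, C f -> C g -> forall i, f i = g i -> f = g.
have [|C [PC maxC]] := @Zorn_bigcup _ P.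
  move=> F FP Ftot f g [B FB Bf] [B' FB' B'g].
  have [BB'|B'B] := Ftot _ _ FB FB'.
    by apply: (FP _ FB') => //; apply: BB'.
  by apply: (FP _ FB) => //; apply: B'B.
have [i iP] : exists i, forall x : A i, exists f, C f /\ f i = x.
  apply: contrapT => /forallNP nP.
  have {}nP i : {x : A i | ~ exists f, C f /\ f i = x}.
    by apply: cid; have /existsNP := nP i.
  pose h i := sval (nP i).
  have hC f i : C f -> f i <> h i.
    by move=> Cf fh; apply: (svalP (nP i)); exists f.
  apply: (maxC (C `|` [set h])).
    split; first by left.
    by move=> /(_ h (or_intror erefl)) /hC /(_ (erefl (h i0))).
  move=> f g [Cf|->] [Cg|->] i //; first exact: PC.
    by move=> /(hC _ _ Cf).
  by move=> /esym /(hC _ _ Cg).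
exists i => j; have {iP} /choice[c cP] := iP.
exists (fun x => c x j) => x y exy.
have [Cx <-] := cP x; have [Cy <-] := cP y.
by rewrite (PC _ _ Cx Cy _ exy).
Qed.

Lemma emb_total T U : emb T U \/ emb U T.
Proof.
have [|[] b] := @emb_least bool (fun b => if b then T else U).
- exact: (inhabits true).
- by left; exact: (b false).
- by right; exact: (b true).
Qed.

Section Hessenberg.
Variable T : Type.
Implicit Types R : set ((T * T) * T).

(** The graphs of the injections [A * A -> A], where [A] is then [fld R]; for a
   set of graphs, Zorn's lemma needs only unions of chains. *)
Let fld R : set T := [set x | exists z, R ((x, x), z)].
Let pairing R :=
  [/\ forall x y, fld R x -> fld R y -> exists2 z, fld R z & R ((x, y), z),
      forall x y z, R ((x, y), z) -> fld R x /\ fld R y,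
      forall p z z', R (p, z) -> R (p, z') -> z = z'
    & forall p p' z, R (p, z) -> R (p', z) -> p = p'].

Let graph S (e : S -> T) (F : S * S -> S) : set ((T * T) * T) :=
  [set t | exists p q, t = ((e p, e q), e (F (p, q)))].

Let fld_graph S (e : S -> T) F : injective e -> fld (graph e F) = range e.
Proof.
move=> ei; apply/seteqP; split=> [x [z [p [q [-> _ _]]]]|x [p _ <-]].
  by exists p.
by exists (e (F (p, p))), p, p.
Qed.

Let pairing_graph S (e : S -> T) F :
  injective e -> injective F -> pairing (graph e F).
Proof.
move=> ei Fi; split; rewrite ?fld_graph //.
- move=> _ _ [p _ <-] [q _ <-]; exists (e (F (p, q))); first by exists (F (p, q)).
  by exists p, q.
- by move=> _ _ _ [p [q [-> -> _]]]; split; [exists p|exists q].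
- by move=> _ _ _ [p [q [-> ->]]] [p' [q' [/ei-> /ei-> ->]]].
- by move=> _ _ _ [p [q [-> ->]]] [p' [q' [-> /ei/Fi[-> ->]]]].
Qed.

Let graphP R : pairing R ->
  exists2 F : {x | fld R x} * {x | fld R x} -> {x | fld R x},
    injective F & R = graph sval F.
Proof.
move=> [Rtot Rfld Rfun Rinj].
have /choice[F FP] (p : {x | fld R x} * {x | fld R x}) :
    exists z : {x | fld R x}, R ((sval p.1, sval p.2), sval z).
  case: p => [[x Ax] [y Ay]] /=; have [z Az Rz] := Rtot _ _ Ax Ay.
  by exists (exist _ z Az).
exists F.
  move=> [[x Ax] [y Ay]] [[x' Ax'] [y' Ay']] eF.
  have := FP (exist _ x Ax, exist _ y Ay).
  rewrite eF => /(Rinj _ _ _ (FP _)) /= -[ex ey].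
  by congr (_, _); apply/eq_exist.
apply/seteqP; split=> [[[x y] z] Rz|_ [p [q ->]]]; last exact: (FP (p, q)).
have [Ax Ay] := Rfld _ _ _ Rz.
exists (exist _ x Ax), (exist _ y Ay); congr (_, _).
exact: (Rfun _ _ _ Rz (FP (exist _ x Ax, exist _ y Ay))).
Qed.

(** A maximal injection [A * A -> A] with [A] infinite: if [A] injected in its
   complement, with image [B], then the pairs of [A `|` B] that are not pairs
   of [A] could be mapped in [B], because [B] has room for three copies of
   [A * A]. So the complement of [A] injects in [A], and [A] is as large as
   the whole type. *)
Lemma emb_square : emb nat T -> emb (T * T) T.
Proof.
move=> [e0 e0i].
pose F0 (p : nat * nat) : nat := pickle p.
have F0i : injective F0 by apply: pcan_inj pickleK.
pose R0 := graph e0 F0.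
(* chains may be empty, so [set0] is admitted; [R0] makes [fld R] infinite *)
have [|R [[R0_eq|[sR0 pR]] maxR]] :=
  @Zorn_bigcup _ (fun R => R = set0 \/ (R0 `<=` R /\ pairing R)).
- move=> FF FFP FFtot.
  have [[R FR Rn0]|/forall2NP all0] := pselect (exists2 R, FF R & R <> set0);
    last first.
    left; apply/seteqP; split=> // t [R FR Rt].
    by have [//|/contrapT R0_eq] := all0 R; rewrite R0_eq in Rt.
  right; have good R' : FF R' -> R' <> set0 -> R0 `<=` R' /\ pairing R'.
    by move=> FR' ?; case: (FFP _ FR').
  have ne0 R' t : R' t -> R' <> set0 by move=> R't R'0; rewrite R'0 in R't.
  have two t t' : (\bigcup_(R in FF) R) t -> (\bigcup_(R in FF) R) t' ->
      exists R', [/\ FF R', R' t & R' t'].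
    move=> [A FA At] [B FB Bt']; have [AB|BA] := FFtot _ _ FA FB.
      by exists B; split=> //; apply: AB.
    by exists A; split=> //; apply: BA.
  split; first by move=> t /(good _ FR Rn0).1 Rt; exists R.
  split.
  + move=> x y [z Uxz] [z' Uyz'].
    have [R' [FR' R'x R'y]] := two _ _ Uxz Uyz'.
    have [_ [tot _ _ _]] := good _ FR' (ne0 _ _ R'x).
    have [||t [t' R't'] R't] := tot x y; [by exists z|by exists z'|].
    by exists t; [exists t'; exists R'|exists R'].
  + move=> x y z [R' FR' R'z].
    have [_ [_ f _ _]] := good _ FR' (ne0 _ _ R'z).
    by have [[t ?] [t' ?]] := f _ _ _ R'z; split; [exists t|exists t']; exists R'.
  + move=> p z z' Uz Uz'; have [R' [FR' R'z R'z']] := two _ _ Uz Uz'.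
    have [_ [_ _ f _]] := good _ FR' (ne0 _ _ R'z).
    exact: f R'z R'z'.
  + move=> p p' z Uz Uz'; have [R' [FR' R'z R'z']] := two _ _ Uz Uz'.
    have [_ [_ _ _ f]] := good _ FR' (ne0 _ _ R'z).
    exact: f R'z R'z'.
- case: (maxR R0); last by right; split=> //; apply: pairing_graph.
  rewrite R0_eq; split=> // /(_ ((e0 0%N, e0 0%N), e0 (F0 (0%N, 0%N)))).
  by apply; exists 0%N, 0%N.
have [F Fi RE] := graphP pR; pose S : Type := {x | fld R x}.
have c n : fld R (e0 n) by exists (e0 (F0 (n, n))); apply: sR0; exists n, n.
pose s n : S := exist _ (e0 n) (c n).
have si : injective s by move=> m n [] /e0i.
have bS : emb (bool * S) S.
  exists (fun p : bool * S => F (s p.1, p.2)) => -[b x] [b' x'] /Fi [eb ->].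
  by congr (_, _); case: b b' eb => [] [] // /e0i.
have TS : emb T S.
  have [[g gi]|[g gi]] := emb_total {x | ~ fld R x} S.
    apply: emb_trans bS.
    pose f x : bool * S := match pselect (fld R x) with
      | left Ax => (true, exist _ x Ax) | right nAx => (false, g (exist _ x nAx)) end.
    exists f => x y; rewrite /f; case: pselect => Ax; case: pselect => Ay //.
      by case.
    by case=> /gi [].
  pose e (p : bool * S) : T := if p.1 then sval (g p.2) else sval p.2.
  have ei : injective e.
    move=> [[] x] [[] y]; rewrite /e /= => exy.
    - by congr (_, _); apply/gi/sval_inj.
    - by have := svalP (g x); rewrite exy => /(_ (svalP y)).
    - by have := svalP (g y); rewrite -exy => /(_ (svalP x)).
    - by congr (_, _); apply/sval_inj.
  (* [s 1], [s 3] and [s 4] keep the three kinds of new pairs apart *)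
  pose F' (pq : (bool * S) * (bool * S)) : bool * S :=
    let: ((b, p), (b', q)) := pq in
    if b || b' then (true, F (s (b + b.*2 + b')%N, F (p, q))) else (false, F (p, q)).
  have F'i : injective F'.
    move=> [[b p] [b' q]] [[a p'] [a' q']]; rewrite /F'.
    by case: b b' a a' => [] [] [] [] //= [];
      first [by move=> /Fi[-> ->] | by move=> /Fi[/Fi[-> ->]] | by move=> /Fi[/e0i]].
  exfalso; apply: (maxR (graph e F')).
    split.
      by move=> t; rewrite {1}RE => -[p [q ->]]; exists (false, p), (false, q).
    move=> sub; have [_ f _ _] := pR; pose p := (true, s 0%N).
    have [|/(svalP (g (s 0%N)))//] := f (e p) (e p) (e (F' (p, p))).
    by apply: sub; exists p, p.
  right; split; last exact: pairing_graph.
  apply: (subset_trans sR0) => t; rewrite {1}RE => -[p [q ->]].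
  by exists (false, p), (false, q).
apply: emb_trans (emb_prod TS TS) _.
by apply: emb_trans (emb_sub (fld R)); exists F.
Qed.

End Hessenberg.

(** * Well-orders and ordinals *)

Section WellOrders.
Variable a : Ord.
Implicit Types x y z : a.

Lemma ole_least (P : set a) :
  P !=set0 -> exists2 x, P x & forall y, P y -> ole x y.
Proof.
move=> [x Px]; have [|m [[/asboolP mP mmin] _]] := @ole_wo a [pred t | `[< P t >]].
  by exists x; apply/asboolP.
by exists m => // y Py; apply/mmin/asboolP.
Qed.

Lemma ole_refl x : ole x x.
Proof. by have [|y -> ] := @ole_least [set x]; [exists x|apply]. Qed.

Lemma ole_total x y : ole x y || ole y x.
Proof.
have [|z [->|->] zmin] := @ole_least [set x; y]; first by exists x; left.
  by rewrite zmin //; right.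
by rewrite zmin ?orbT //; left.
Qed.

Lemma ole_trans y x z : ole x y -> ole y z -> ole x z.
Proof.
move=> xy yz; have [|t [[->|->]|->] tmin] := @ole_least [set x; y; z].
- by exists x; do 2!left.
- by apply: tmin; right.
- by rewrite (@ole_anti a x y) // xy tmin //; do 2!left.
by rewrite (@ole_anti a z y) // yz tmin //; left; right.
Qed.

Lemma oltNge x y : olt x y <-> ~ ole y x.
Proof. by split=> [/negP|/negP]. Qed.

Lemma ole_ltF x y : ole x y -> ~ olt y x.
Proof. by move=> xy /negP. Qed.

Lemma oltW x y : olt x y -> ole x y.
Proof. by move=> /negPf nyx; have := ole_total x y; rewrite nyx orbF. Qed.

Lemma ole_lt_trans y x z : ole x y -> olt y z -> olt x z.
Proof. by move=> xy /negP yz; apply/negP => zx; apply/yz/(ole_trans zx). Qed.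

Lemma olt_le_trans y x z : olt x y -> ole y z -> olt x z.
Proof. by move=> /negP xy yz; apply/negP => zx; apply/xy/(ole_trans yz). Qed.

Lemma olt_irrefl x : ~ olt x x.
Proof. by rewrite /olt ole_refl. Qed.

Lemma ole_or_lt x y : ole x y \/ olt y x.
Proof. by rewrite /olt; case: (ole x y); [left|right]. Qed.

Lemma ole_eqVlt x y : ole x y -> x = y \/ olt x y.
Proof.
have [yx xy|] := ole_or_lt y x; last by right.
by left; apply: ole_anti; rewrite xy.
Qed.

Lemma olt_neq x y : x <> y -> olt x y \/ olt y x.
Proof.
have [/ole_eqVlt[//|]|] := ole_or_lt x y; first by left.
by right.
Qed.

Lemma olt_wf : well_founded (@olt a).
Proof.
move=> x; apply: contrapT => nAx.
have [|y nAy ymin] := @ole_least [set y | ~ Acc (@olt a) y]; first by exists x.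
by apply: nAy; split=> z zy; apply: contrapT => /ymin/ole_ltF; apply.
Qed.

Lemma ole_max x y : exists z, ole x z /\ ole y z.
Proof.
by case/orP: (ole_total x y) => ?; [exists y|exists x]; split; rewrite ?ole_refl.
Qed.

End WellOrders.

Lemma sub_ole_wo (a : Ord) (P : set a) :
  well_order (fun x y : {x | P x} => ole (sval x) (sval y)).
Proof.
apply: antisymmetric_well_order => [x y /ole_anti/sval_inj//|A [x xA]].
have [|y [y' y'A <-] ymin] := @ole_least a (sval @` [set x | x \in A]).
  by exists (sval x), x.
by exists y'; split=> // z zA; apply: ymin; exists z.
Qed.

Definition seg (a : Ord) (z : a) : Ord := MkOrd (@sub_ole_wo a (fun y => olt y z)).

Definition in_seg (a : Ord) (z y : a) (yz : olt y z) : seg z := exist _ y yz.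

Lemma emb_seg (a : Ord) (z : a) : emb (seg z) a.
Proof. exact: emb_sub. Qed.

Lemma emb_seg_le (a : Ord) (x y : a) : ole x y -> emb (seg x) (seg y).
Proof.
move=> xy; exists (fun t : seg x => in_seg (olt_le_trans (svalP t) xy)).
by move=> s t [/sval_inj].
Qed.

(** ** Isomorphism and comparison of ordinals *)

Lemma ord_isoI (a b : Ord) (f : a -> b) :
  {mono f : x y / ole x y} -> (forall y, exists x, f x = y) -> ord_iso a b.
Proof.
move=> fm /choice[g gK]; exists f => //; exists g => // x.
by apply: ole_anti; rewrite -!fm !gK !ole_refl.
Qed.

Lemma mono_inj (a b : Ord) (f : a -> b) : {mono f : x y / ole x y} -> injective f.
Proof. by move=> fm x y fxy; apply: ole_anti; rewrite -!fm fxy !ole_refl. Qed.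

Lemma ord_iso_refl a : ord_iso a a.
Proof. by apply: (@ord_isoI _ _ id) => // y; exists y. Qed.

Lemma ord_iso_sym a b : ord_iso a b -> ord_iso b a.
Proof.
move=> [f fm [g fK gK]]; apply: (@ord_isoI _ _ g) => [x y|y].
  by rewrite -fm !gK.
by exists (f y).
Qed.

Lemma ord_iso_trans b a c : ord_iso a b -> ord_iso b c -> ord_iso a c.
Proof.
move=> [f fm [f' fK f'K]] [g gm [g' gK g'K]].
apply: (@ord_isoI _ _ (g \o f)) => [x y|y] /=; first by rewrite gm fm.
by exists (f' (g' y)); rewrite f'K g'K.
Qed.

Lemma ord_iso_emb a b : ord_iso a b -> emb a b.
Proof. by move=> [f /mono_inj fi _]; exists f. Qed.

Lemma ord_ltP a b : (a < b)%Ord <-> exists z : b, ord_iso a (seg z).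
Proof.
split=> [[z [f [fm fr]]]|[z [f fm [g fK gK]]]]; exists z.
  have fz x : olt (f x) z by have : range f (f x) by []; rewrite fr.
  apply: (@ord_isoI _ _ (fun x => in_seg (fz x))) => // -[y yz].
  have : range f y by rewrite fr.
  by move=> [x _ fx]; exists x; apply: sval_inj.
exists (fun x => sval (f x)); split=> [x y|]; first by rewrite -fm.
apply/seteqP; split=> [_ [x _ <-]|y yz]; first exact: (svalP (f x)).
by exists (g (in_seg yz)); rewrite // gK.
Qed.

Lemma seg_lt (a : Ord) (z : a) : (seg z < a)%Ord.
Proof. by apply/ord_ltP; exists z; apply: ord_iso_refl. Qed.

Lemma ord_iso_lt a b a' b' :
  ord_iso a a' -> ord_iso b b' -> (a < b)%Ord -> (a' < b')%Ord.
Proof.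
move=> /ord_iso_sym aa' [g gm [h gK hK]] /ord_ltP[z az].
apply/ord_ltP; exists (g z); apply: (ord_iso_trans aa'); apply: (ord_iso_trans az).
have gz (x : seg z) : olt (g (sval x)) (g z) by rewrite /olt gm; apply: (svalP x).
apply: (@ord_isoI _ _ (fun x => in_seg (gz x))) => [x y|[y yz]]; first exact: gm.
have hz : olt (h y) z by rewrite /olt -gm hK.
by exists (in_seg hz); apply: sval_inj; rewrite /= hK.
Qed.

Lemma seg_seg (a : Ord) (z : a) (s : seg z) : ord_iso (seg s) (seg (sval s)).
Proof.
pose f (t : seg s) : seg (sval s) := in_seg (svalP t : olt (sval (sval t)) (sval s)).
apply: (@ord_isoI _ _ f) => // -[y ys].
have yz : olt y z := olt_le_trans ys (oltW (svalP s)).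
by exists (@in_seg (seg z) s (in_seg yz) ys); apply: sval_inj.
Qed.

Lemma seg_mono (a : Ord) (x y : a) : olt x y -> (seg x < seg y)%Ord.
Proof.
by move=> xy; apply/ord_ltP; exists (in_seg xy); apply/ord_iso_sym/seg_seg.
Qed.

Lemma ord_lt_trans b a c : (a < b)%Ord -> (b < c)%Ord -> (a < c)%Ord.
Proof.
move=> /[swap] /ord_ltP[z bz] /(ord_iso_lt (ord_iso_refl _) bz)/ord_ltP[s as_].
by apply/ord_ltP; exists (sval s); apply: ord_iso_trans as_ (seg_seg s).
Qed.

(** A descent: the least point that an increasing map moves down would be
   mapped to a smaller such point. *)
Lemma ord_lt_irrefl a : ~ (a < a)%Ord.
Proof.
move=> [z [f [fm fr]]].
have fz : olt (f z) z by have : range f (f z) by []; rewrite fr.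
have [|x fx xmin] := @ole_least a [set x | olt (f x) x]; first by exists z.
have ffx : olt (f (f x)) (f x) by rewrite /olt fm.
exact: (ole_ltF (xmin _ ffx) fx).
Qed.

Lemma ord_le_lt_trans b a c : (a <= b)%Ord -> (b < c)%Ord -> (a < c)%Ord.
Proof.
move=> [ab|/ord_iso_sym ab]; first exact: ord_lt_trans.
by apply: ord_iso_lt => //; apply: ord_iso_refl.
Qed.

Lemma ord_lt_le_trans b a c : (a < b)%Ord -> (b <= c)%Ord -> (a < c)%Ord.
Proof.
move=> + [bc|bc]; first by move/ord_lt_trans; apply.
by apply: ord_iso_lt => //; apply: ord_iso_refl.
Qed.

Lemma seg_lt_inv (a : Ord) (x y : a) : (seg x < seg y)%Ord -> olt x y.
Proof.
move=> xy; apply/oltNge => yx; apply: (@ord_lt_irrefl (seg x)).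
have [yx_eq|/seg_mono yx'] := ole_eqVlt yx; first by rewrite yx_eq in xy *.
exact: ord_lt_trans yx'.
Qed.

(** ** Sums with finite ordinals *)

Definition nat_ord_elt n i (h : (i < n)%N) : ord_nat n := exist _ i h.

Lemma ord_nat0_empty : ord_nat 0 -> False.
Proof. by case. Qed.

Lemma ord_add_iso a b a' b' :
  ord_iso a a' -> ord_iso b b' -> ord_iso (a + b)%Ord (a' + b')%Ord.
Proof.
move=> [f fm [f' fK f'K]] [g gm [g' gK g'K]].
pose h (u : (a + b)%Ord) : (a' + b')%Ord :=
  match u with inl x => inl (f x) | inr y => inr (g y) end.
apply: (@ord_isoI _ _ h) => [[x|x] [y|y]|[y|y]] //=; rewrite ?fm ?gm //.
  by exists (inl (f' y)) => /=; rewrite f'K.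
by exists (inr (g' y)) => /=; rewrite g'K.
Qed.

Lemma seg_add_inr (a b : Ord) (z : b) :
  ord_iso (seg (inr z : (a + b)%Ord)) (a + seg z)%Ord.
Proof.
apply: ord_iso_sym.
have hz (u : (a + seg z)%Ord) :
    olt (match u with inl x => inl x | inr y => inr (sval y) end : (a + b)%Ord) (inr z).
  by case: u => [//|y]; apply: (svalP y).
apply: (@ord_isoI _ _ (fun u => in_seg (hz u))) => [[x|x] [y|y]|[[y|y] yz]] //.
  by exists (inl y); apply: sval_inj.
by exists (inr (in_seg (yz : olt y z))); apply: sval_inj.
Qed.

Lemma seg_add_inl (a b : Ord) (z : a) :
  ord_iso (seg (inl z : (a + b)%Ord)) (seg z).
Proof.
apply: ord_iso_sym.
have hz (u : seg z) : olt (inl (sval u) : (a + b)%Ord) (inl z) by apply: (svalP u).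
apply: (@ord_isoI _ _ (fun u => in_seg (hz u))) => [//|[[y|y] yz]] //.
by exists (in_seg (yz : olt y z)); apply: sval_inj.
Qed.

Lemma ord_add_empty (a b : Ord) : (b -> False) -> ord_iso a (a + b)%Ord.
Proof. by move=> b0; apply: (@ord_isoI _ (a + b)%Ord inl) => // -[y|/b0//]; exists y. Qed.

Lemma ord_lt_add (a b : Ord) (z : b) : (a < a + b)%Ord.
Proof.
have [|x _ xmin] := @ole_least b setT; first by exists z.
apply/ord_ltP; exists (inr x); apply: ord_iso_sym.
apply: ord_iso_trans (seg_add_inr _ _) (ord_iso_sym _).
by apply: ord_add_empty => -[y /oltNge]; apply; apply: xmin.
Qed.

Lemma ord_lt_add2l (c a b : Ord) : (a < b)%Ord -> (c + a < c + b)%Ord.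
Proof.
move=> /ord_ltP[z az]; apply/ord_ltP; exists (inr z).
apply: ord_iso_trans (ord_iso_sym (seg_add_inr _ _)).
by apply: ord_add_iso => //; apply: ord_iso_refl.
Qed.

Lemma ord_lt_nonempty (a b : Ord) : (a < b)%Ord -> inhabited b.
Proof. by move=> /ord_ltP[z _]. Qed.

Lemma ord_iso_empty (a b : Ord) : (a -> False) -> (b -> False) -> ord_iso a b.
Proof.
move=> a0 b0; apply: (@ord_isoI _ _ (fun x => match a0 x with end)) => [x|y].
  by case: (a0 x).
by case: (b0 y).
Qed.

Definition one_pt : ord_nat 1 := nat_ord_elt (ltnSn 0).

Lemma ord1_eq (x : ord_nat 1) : x = one_pt.
Proof. by case: x => -[|//] h; apply: sval_inj. Qed.

Lemma ord_one_ne (a : Ord) : (ord_nat 1 <= a)%Ord -> inhabited a.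
Proof. by move=> [/ord_lt_nonempty|[f _ _]] //; split; exact: f one_pt. Qed.

Lemma one_le_lt_add (a c : Ord) : (ord_nat 1 <= c)%Ord -> (c < ord_nat 1 + a)%Ord ->
  exists z : a, ord_iso c (ord_nat 1 + seg z)%Ord.
Proof.
move=> /ord_one_ne[x] /ord_ltP[[u|z] cz]; last first.
  by exists z; apply: ord_iso_trans cz (seg_add_inr _ _).
have [f _ _] := cz; have [[v|v] vu] := f x => //.
by case: (@olt_irrefl (ord_nat 1) one_pt); move: vu; rewrite (ord1_eq v) (ord1_eq u).
Qed.

Lemma seg_add1_top (a : Ord) : ord_iso (seg (inr one_pt : (a + ord_nat 1)%Ord)) a.
Proof.
apply: ord_iso_trans (seg_add_inr _ _) (ord_iso_sym _); apply: ord_add_empty.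
by move=> [y]; rewrite (ord1_eq y) => /olt_irrefl.
Qed.

Lemma ord_max_succ (a : Ord) (z : a) :
  (forall x, ole x z) -> ord_iso a (seg z + ord_nat 1)%Ord.
Proof.
move=> zmax; apply: ord_iso_sym.
pose f (u : (seg z + ord_nat 1)%Ord) : a :=
  match u with inl x => sval x | inr _ => z end.
apply: (@ord_isoI _ _ f) => [[x|x] [y|y]|y] /=.
- by [].
- by rewrite zmax.
- by apply/negbTE; exact: (svalP y).
- by rewrite ole_refl (ord1_eq x) (ord1_eq y).
have [->|yz] := ole_eqVlt (zmax y); first by exists (inr one_pt).
by exists (inl (in_seg yz)).
Qed.

Lemma ord_add_nat2 (a : Ord) n :
  ord_iso (a + ord_nat n.+2)%Ord (a + ord_nat n + ord_nat 1 + ord_nat 1)%Ord.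
Proof.
have step (b : Ord) m : ord_iso (b + ord_nat m.+1)%Ord (b + ord_nat m + ord_nat 1)%Ord.
  apply: ord_iso_sym.
  pose f (u : (b + ord_nat m + ord_nat 1)%Ord) : (b + ord_nat m.+1)%Ord :=
    match u with
    | inl (inl x) => inl x
    | inl (inr i) => inr (nat_ord_elt (leqW (svalP i)))
    | inr _ => inr (nat_ord_elt (ltnSn m))
    end.
  apply: (@ord_isoI _ _ f) =>
    [[[x|[i im]]|[[|//] ?]] [[y|[j jm]]|[[|//] ?]]|[y|[i im]]] //=.
  - by rewrite /nat_ole /= (ltnW im).
  - by rewrite /nat_ole /= leqNgt jm.
  - by rewrite /nat_ole /= leqnn.
  - by exists (inl (inl y)).
  - have [im'|im'] := ltnP i m.
      by exists (inl (inr (nat_ord_elt im'))); congr inr; apply: sval_inj.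
    exists (inr one_pt); congr inr; apply: sval_inj => /=.
    by apply/eqP; rewrite eqn_leq im' -ltnS im.
apply: ord_iso_trans (step _ _) _; apply: ord_add_iso (step _ _) (ord_iso_refl _).
Qed.

Lemma ord_limit_nomax (l : Ord) :
  ord_limit l -> inhabited l /\ forall z : l, exists w, olt z w.
Proof.
move=> [/ord_lt_nonempty l0 lS]; split=> // z.
have /ord_ltP[w zw] := lS _ (seg_lt z); exists w.
apply: seg_lt_inv; apply: ord_iso_lt (ord_iso_refl _) zw _.
exact: (ord_lt_add _ one_pt).
Qed.

(** Nothing is below [0], the default value of [ord_min], so a strict bound by
   [ord_min P] tells that the minimum exists. *)
Lemma lt_ord_min (P : Ord -> Prop) a : (a < ord_min P)%Ord ->
  P (ord_min P) /\ forall b, P b -> (ord_min P <= b)%Ord.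
Proof.
rewrite /ord_min; case: pselect => [ex _|_ /ord_lt_nonempty[/ord_nat0_empty]//].
exact: (svalP (cid ex)).
Qed.

(** Both ordinals are initial segments of [card_succ k], where they can be
   compared: were [a] larger than [k] in cardinality, the least initial segment
   of [a] with this property would be a cardinal in between. *)
Lemma lt_card_succ (k a : Ord) : (a < card_succ k)%Ord -> emb a k.
Proof.
move=> a_lt; have [[mcard km] mmin] := lt_ord_min a_lt.
set m := card_succ k in a_lt mcard km mmin.
have /ord_ltP[z az] := a_lt; have /ord_ltP[w kw] := km.
apply: contrapT => na.
have [|y ny ymin] := @ole_least m [set y | ~ emb (seg y) k].
  by exists z => sz; apply: na; apply: emb_trans sz; apply: ord_iso_emb.
have yz : ole y z.
  by apply: ymin => sz; apply: na; apply: emb_trans sz; apply: ord_iso_emb.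
have wy : olt w y.
  apply/oltNge => yw; apply: ny; apply: emb_trans (emb_seg_le yw) _.
  exact/ord_iso_emb/ord_iso_sym.
apply: (@ord_lt_irrefl m); apply: (@ord_le_lt_trans (seg y)); last exact: seg_lt.
apply: mmin; split; last first.
  exact: ord_iso_lt (ord_iso_sym kw) (ord_iso_refl _) (seg_mono wy).
move=> b /ord_ltP[s bs]; rewrite card_eq_le => /andP[_ yb]; apply: ny.
apply: emb_trans (emb_setT yb) _; apply: emb_trans (ord_iso_emb bs) _.
apply: emb_trans (ord_iso_emb (seg_seg s)) _.
by apply: contrapT => /ymin/ole_ltF; apply; apply: (svalP s).
Qed.

(** * Cofinal families *)

(** The least initial segment as large as [T], in a well-order of [T]. *)
Lemma initial_order T : exists (o : Ord) (c : o -> T),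
  [/\ forall x, exists d, c d = x, emb o T & forall t : o, ~ emb T (seg t)].
Proof.
have [R Rwo] : exists R : rel T, well_order R.
  by elim/Peq : T => T; have [R ?] := well_ordering_principle T; exists R.
pose W := MkOrd Rwo.
have [[t tT]|nT] := pselect (exists t : W, emb T (seg t)); last first.
  exists W, id; split=> [x||t tT]; [by exists x|exact: emb_refl|].
  by apply: nT; exists t.
have [|m mT mmin] := @ole_least W [set t | emb T (seg t)]; first by exists t.
have [c csurj] := @emb_surj T (seg m) t mT.
exists (seg m), c; split=> //; first exact: (emb_seg m).
move=> s /emb_trans/(_ (ord_iso_emb (seg_seg s))).
by move=> /mmin/ole_ltF; apply; apply: (svalP s).
Qed.

Definition cofinal (I : Ord) J (h : J -> I) := forall i, exists j, ole i (h j).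

Definition nomax (I : Ord) := inhabited I /\ forall i : I, exists j, olt i j.

Section Cofinal.
Variable I : Ord.
Hypothesis I_nomax : nomax I.

Lemma cofinal_lt J (h : J -> I) : cofinal h -> forall i, exists j, olt i (h j).
Proof.
move=> hcof i; have [i' ii'] := I_nomax.2 i; have [j i'j] := hcof i'.
by exists j; apply: olt_le_trans i'j.
Qed.

Lemma not_cofinal J (h : J -> I) : ~ cofinal h -> exists i, forall j, olt (h j) i.
Proof.
move=> /existsNP[i /forallNP ni]; exists i => j; exact/oltNge/ni.
Qed.

Lemma cofinal_infinite J (h : J -> I) : cofinal h -> emb nat J.
Proof.
move=> hcof; have [i0] := I_nomax.1; have [j0 _] := hcof i0.
have /choice[next nextP] j := cofinal_lt hcof (h j).
have incr m n : (m < n)%N -> olt (h (iter m next j0)) (h (iter n next j0)).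
  elim: n => // n IHn; rewrite ltnS leq_eqVlt => /orP[/eqP->|/IHn mn].
    exact: nextP.
  exact: ole_lt_trans (oltW mn) (nextP _).
exists (fun n => iter n next j0) => m n emn.
have [/incr|/incr|//] := ltngtP m n; rewrite emn => /olt_irrefl [].
Qed.

(** A least cofinal subset [E] of [J], listed by an initial ordinal: a subset of
   [E] as large as [E] is then met above every stage, and along a subfamily
   that dominates all the earlier values this makes it cofinal. As [E * E]
   injects in [E], there is room for [E] many disjoint such subsets. *)
Lemma cofinal_split J (h : J -> I) : cofinal h ->
  exists (D : Type) (g : D -> I) (N : D -> set J),
    [/\ cofinal g, emb D J, forall l l' j, N l j -> N l' j -> l = l'
      & forall l i, exists2 j, N l j & ole i (h j)].
Proof.
move=> hcof; pose restr (S : set J) (j : {j | S j}) := h (sval j).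
have [|[E Ecof] /= Emin] :=
    @emb_least {S : set J | cofinal (@restr S)} (fun S => {j | sval S j}).
  by split; exists setT => i; have [j ij] := hcof i; exists (exist _ j Logic.I).
have {}Emin (S : set J) : (forall i, exists2 j, S j & ole i (h j)) ->
    emb {j | E j} {j | S j}.
  move=> Scof; have Scof' : cofinal (@restr S).
    by move=> i; have [j Sj ij] := Scof i; exists (exist _ j Sj).
  exact: (Emin (exist _ S Scof')).
pose T : Type := {j | E j}.
have [o [c [csurj _ oinit]]] := initial_order T.
pose f d := h (sval (c d)).
(* the values of [f] before [d] are too few to be cofinal, so one index [e d]
   dominates them all *)
have /choice[e eP] (d : o) :
    exists j : T, forall d', ole d' d -> ole (f d') (h (sval j)).
  have [y yP] : exists y, forall d', olt d' d -> ole (f d') y.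
    apply: contrapT => /forallNP ny; apply: (oinit d).
    pose S := [set j | exists2 d', olt d' d & j = sval (c d')].
    apply: (@emb_trans _ {j | S j}).
      apply: Emin => i; have /existsNP[d' /not_implyP[d'd di]] := ny i.
      exists (sval (c d')); first by exists d'.
      by apply: oltW; apply/oltNge.
    have /choice[g gP] (j : {j | S j}) : exists d' : seg d, sval j = sval (c (sval d')).
      by have [d' d'd jd'] := svalP j; exists (in_seg d'd).
    by exists g => x y gxy; apply: sval_inj; rewrite gP [RHS]gP gxy.
  have [z [yz fz]] := ole_max y (f d).
  have [j zj] := Ecof z; exists j => d' /ole_eqVlt[->|/yP d'y].
    exact: ole_trans fz zj.
  exact: ole_trans d'y (ole_trans yz zj).
have fcof : cofinal f.
  move=> i; have [j ij] := Ecof i; have [d cd] := csurj j.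
  by exists d; rewrite /f cd.
have Tran : emb T {j | range (sval \o e) j}.
  apply: Emin => i; have [d id_] := fcof i; exists (sval (e d)); first by exists d.
  by apply: ole_trans id_ (eP d d _); apply: ole_refl.
have [q qi] : emb (T * T) {j | range (sval \o e) j}.
  exact: emb_trans (emb_square (cofinal_infinite Ecof)) Tran.
exists T, (@restr E), (fun l => [set sval (q (l, l')) | l' in setT]); split=> //.
- exact: emb_sub.
- by move=> l l' _ [m _ <-] [m' _ /sval_inj/qi[]].
move=> l i; have /choice[r rP] (l' : T) : exists d, sval (q (l, l')) = sval (e d).
  by have [d _ <-] := svalP (q (l, l')); exists d.
have ri : injective r.
  by move=> x y rxy; have := rP x; rewrite rxy -rP => /sval_inj/qi[].
have [t it] := fcof i.
have [l' tl'] : exists l', ole t (r l').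
  apply: contrapT => /forallNP nt; apply: (oinit t).
  have rt l' : olt (r l') t by apply/oltNge/nt.
  by exists (fun l' => in_seg (rt l')) => x y [/ri].
exists (sval (q (l, l'))); first by exists l'.
by rewrite rP; apply: ole_trans it (eP _ _ _).
Qed.

End Cofinal.

(** * Singular strong limit cardinals *)

Section Small.
Variable k : Ord.

Definition small (T : Type) := exists z : k, emb T (seg z).

Lemma small_emb T U : emb T U -> small U -> small T.
Proof. by move=> TU [z Uz]; exists z; apply: emb_trans Uz. Qed.

Lemma small_seg (z : k) : small (seg z).
Proof. by exists z; apply: emb_refl. Qed.

Lemma small_lt (d : Ord) : (d < k)%Ord -> small d.
Proof. by move=> /ord_ltP[z /ord_iso_emb dz]; exists z. Qed.

(** The last condition only bounds [2 ^ z] by [k] for [z < k]; together with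
   singularity it makes [k] a strong limit, see [small_powerset]. *)
Definition singular_strong_limit :=
  [/\ forall z : k, ~ emb k (seg z), ~ emb k nat,
      exists (w : k) (f : seg w -> k), cofinal f & emb (binseq_lt k) k].

Hypothesis k_ssl : singular_strong_limit.

Lemma emb_nat_self : emb nat k.
Proof. by have [_ kunc _ _] := k_ssl; have [/kunc|] := emb_total k nat. Qed.

Lemma emb_square_self : emb (k * k) k.
Proof. exact: emb_square emb_nat_self. Qed.

(** Removing a point from an infinite set does not change its cardinality. *)
Lemma nomax_self : nomax k.
Proof.
have [kcard kunc [w [_ _]] _] := k_ssl; split=> [//|z].
apply: contrapT => /forallNP nz.
have {nz} zmax x : ole x z by have /oltNge/contrapT := nz x.
have kS : emb k (option (seg z)).
  have /choice[f fP] (x : k) : exists u : option (seg z),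
      x = match u with Some y => sval y | None => z end.
    have [->|xz] := ole_eqVlt (zmax x); first by exists None.
    by exists (Some (in_seg xz)).
  by exists f => x y fxy; rewrite (fP x) fxy -fP.
have [Sn|nS] := emb_total (seg z) nat.
  apply: kunc; apply: emb_trans kS _; have [g gi] := Sn.
  exists (fun u => if u is Some y then (g y).+1 else 0%N).
  by move=> [x|] [y|] //= [/gi->].
apply: (kcard z); apply: emb_trans kS _; have [s si] := nS.
apply: emb_trans (emb_square nS).
exists (fun u => if u is Some y then (s 0%N, y) else (s 1%N, s 0%N)).
by move=> [x|] [y|] //= [] => [->|/si|/si].
Qed.

(** Singularity: [k] is a union of fewer than [k] initial segments, each of which
   injects in [T], so [k] injects in the square of [T]. *)
Lemma not_small T : ~ small T -> emb k T.
Proof.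
have [kcard kunc [w [f fcof]] _] := k_ssl; move=> nT.
have zT (z : k) : emb (seg z) T.
  by have [//|Tz] := emb_total (seg z) T; case: nT; exists z.
have kTT : emb k (T * T).
  have /choice[i iP] (x : k) := cofinal_lt nomax_self fcof x.
  have [g gi] : {g : forall i, seg (f i) -> T | forall i, injective (g i)}.
    by exists (fun i => sval (cid (zT (f i)))) => j; apply: (svalP (cid _)).
  apply: emb_trans (emb_prod (zT w) (emb_refl T)).
  exists (fun x => (i x, g (i x) (in_seg (iP x)))) => x y [exy].
  move: (iP x) (iP y); rewrite exy => px py.
  by move=> /gi [].
have [Tn|nT'] := emb_total T nat; last exact: emb_trans (emb_square nT').
case: kunc; apply: emb_trans kTT _; apply: emb_trans (emb_prod Tn Tn) _.
exact: emb_square (emb_refl _).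
Qed.

Lemma small_nat : small nat.
Proof. by have [_ kunc _ _] := k_ssl; apply: contrapT => /not_small/kunc. Qed.

Lemma small_self T : small T -> emb T k.
Proof. by move=> [z /emb_trans]; apply; apply: emb_seg. Qed.

Lemma small_prod T U : small T -> small U -> small (T * U).
Proof.
move=> [x Tx] [y Uy]; have [z [xz yz]] := ole_max x y.
have {Tx Uy} TUz : emb (T * U) (seg z * seg z).
  apply: emb_prod; first exact: emb_trans (emb_seg_le xz).
  exact: emb_trans (emb_seg_le yz).
apply: (small_emb TUz); have [zn|nz] := emb_total (seg z) nat.
  apply: small_emb (emb_prod zn zn) _; apply: small_emb small_nat.
  exact: emb_square (emb_refl _).
by apply: small_emb (small_seg z); apply: emb_square.
Qed.

Lemma emb_seg_powerset (z : k) : emb (seg z -> bool) k.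
Proof.
have [_ _ _ kpow] := k_ssl; apply: emb_trans kpow.
exists (fun s => existT _ z s) => s s' ess'.
(* a map defined for all lengths, so as not to invert [existT] *)
pose ext (p : binseq_lt k) : set k :=
  [set x | exists h : olt x (tag p), tagged p (exist _ x h)].
have extE s0 x : ext (existT _ z s0) (sval x) = s0 x.
  have xE (h : olt (sval x) z) : exist _ (sval x) h = x by apply: sval_inj.
  by apply/propext; split=> [[h] /=|sx]; [|exists (svalP x) => /=]; rewrite xE.
apply/funext => x; apply/idP/idP => sx.
  by rewrite -extE -ess' extE.
by rewrite -extE ess' extE.
Qed.

(** König's argument: a map from [k] to the functions [cof k -> k] misses a
   function, since for each [i] the values at [i] of its first [f i] terms do
   not exhaust [k]. *)
Lemma cof_functions_large (w : k) (f : seg w -> k) : cofinal f -> ~ emb (seg w -> k) k.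
Proof.
have [kcard _ _ _] := k_ssl; move=> fcof [G Gi].
have /choice[g gP] (i : seg w) : exists y, forall h, h i = y -> ~ olt (G h) (f i).
  apply: contrapT => /forallNP ny; apply: (kcard (f i)).
  have /choice[H HP] y : exists h, h i = y /\ olt (G h) (f i).
    have /existsNP[h /not_implyP[hy /contrapT hf]] := ny y.
    by exists h.
  exists (fun y => in_seg (HP y).2) => x y [/Gi exy].
  by rewrite -(HP x).1 -(HP y).1 exy.
have [i Gf] := cofinal_lt nomax_self fcof (G g).
exact: (gP i g).
Qed.

(** If [2 ^ T] were at least [k] then [k ^ (cof k) <= 2 ^ (T * cof k) <= k]. *)
Lemma small_powerset T : small T -> small (T -> bool).
Proof.
have [_ _ [w [f fcof]] _] := k_ssl; move=> sT; apply: contrapT => /not_small[F Fi].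
apply: (cof_functions_large fcof).
have [z [e ei]] := small_prod sT (small_seg w).
apply: emb_trans (emb_seg_powerset z).
exists (fun h s => `[< exists p, e p = s /\ F (h p.2) p.1 >]).
have key h p : `[< exists p', e p' = e p /\ F (h p'.2) p'.1 >] = F (h p.2) p.1.
  by apply/asboolP/idP => [[p' [/ei->]]//|Fp]; exists p.
move=> h h' ehh'; apply/funext => i; apply: Fi; apply/funext => t.
have := congr1 (fun s => s (e (t, i))) ehh'.
by rewrite (key h (t, i)) (key h' (t, i)).
Qed.

Lemma small_fun T U : small T -> small U -> small (T -> U).
Proof.
move=> sT sU; apply: small_emb (small_powerset (small_prod sT sU)).
exists (fun f p => `[< f p.1 = p.2 >]) => f g efg; apply/funext => t.
apply/esym/asboolP; have := congr1 (fun s => s (t, f t)) efg => /= <-.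
exact/asboolP.
Qed.

Lemma small_bool : small bool.
Proof.
by apply: small_emb small_nat; exists nat_of_bool => -[] [].
Qed.

Lemma small_unit : small unit.
Proof. by apply: small_emb small_nat; exists (fun=> 0%N) => -[] []. Qed.

Lemma emb_sum_self (J : Type) (T : J -> Type) :
  emb J k -> (forall j, emb (T j) k) -> emb {j & T j} k.
Proof.
move=> Jk Tk; apply: emb_trans emb_square_self.
apply: emb_trans (emb_prod Jk (emb_refl k)).
have [e ei] : {e : forall j, T j -> k | forall j, injective (e j)}.
  by exists (fun j => sval (cid (Tk j))) => j; apply: (svalP (cid _)).
exists (fun p => (tag p, e (tag p) (tagged p))) => -[j x] [j' x'] /= [ej].
by case: _ / ej x' => x' /ei ->.
Qed.

Lemma small_sum T U : small T -> small U -> small (T + U).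
Proof.
move=> [x [f fi]] [y [g gi]]; have [z [xz yz]] := ole_max x y.
apply: small_emb (small_prod small_bool (small_seg z)).
have [f' f'i] := emb_seg_le xz; have [g' g'i] := emb_seg_le yz.
exists (fun u => match u with inl t => (true, f' (f t)) | inr t => (false, g' (g t)) end).
by move=> [t|t] [t'|t'] // [] => [/f'i/fi->|/g'i/gi->].
Qed.

Lemma small_option T : small T -> small (option T).
Proof.
move=> sT; apply: small_emb (small_sum sT small_unit).
by exists (fun u => if u is Some t then inl t else inr tt) => -[t|] [t'|] // [->].
Qed.

(** To group [k] objects in a small number of small batches. *)
Lemma small_exhaustion : exists (W : Type) (S : W -> set k),
  [/\ small W, forall w, small {x | S w x} & forall x, exists w, S w x].
Proof.
have [_ _ [w [f fcof]] _] := k_ssl; exists (seg w), (fun i x => olt x (f i)).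
split=> [|i|]; [exact: small_seg|exact: (small_seg (f i))|move=> x].
exact: (cofinal_lt nomax_self fcof x).
Qed.

(** The supremum of one of the small pieces of [a] is the whole of [a], or else
   their suprema form a small cofinal set. *)
Lemma small_cofinal (a : Ord) : nomax a -> emb a k ->
  exists (D : Type) (g : D -> a), small D /\ cofinal g.
Proof.
move=> a_nomax [e ei]; have [W [S [sW sS cov]]] := small_exhaustion.
pose g w (x : {x | S w (e x)}) := sval x.
have [[w gcof]|ncof] := pselect (exists w, cofinal (@g w)).
  exists {x | S w (e x)}, (@g w); split=> //; apply: small_emb (sS w).
  exists (fun x : {x | S w (e x)} => exist (S w) (e (sval x)) (svalP x)).
  by move=> x y [/ei/sval_inj].
have /choice[b bP] w : exists i, forall x, olt (@g w x) i.
  by apply: not_cofinal => gcof; apply: ncof; exists w.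
exists W, b; split=> // x; have [w Sx] := cov (e x).
by exists w; apply: oltW; apply: (bP w (exist _ x Sx)).
Qed.

End Small.

(** * Unions of fewer than [k] sets *)

Section SmallUnions.
Variables (k : Ord) (T : Type).
Hypothesis k_ssl : singular_strong_limit k.
Implicit Types C : set (set T).

Definition small_unions C : set (set T) :=
  [set A | exists (J : Type) (B : J -> set T),
    [/\ small k J, forall j, C (B j) & A = \bigcup_j B j]].

Lemma small_unions_bigcup C (J : Type) (B : J -> set T) :
  small k J -> (forall j, C (B j)) -> small_unions C (\bigcup_j B j).
Proof. by move=> sJ CB; exists J, B. Qed.

Lemma small_unionsW C : C `<=` small_unions C.
Proof.
move=> A CA; exists unit, (fun=> A); split=> //; first exact: small_unit.
by apply/seteqP; split=> [x Ax|x [_ _]//]; exists tt.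
Qed.

Lemma sub_small_unions C C' : C `<=` C' -> small_unions C `<=` small_unions C'.
Proof. by move=> CC' _ [J [B [sJ CB ->]]]; exists J, B; split=> // j; apply: CC'. Qed.

Lemma small_unionsU C A A' :
  small_unions C A -> small_unions C A' -> small_unions C (A `|` A').
Proof.
move=> [J [B [sJ CB ->]]] [J' [B' [sJ' CB' ->]]].
exists (J + J')%type, (fun j => match j with inl i => B i | inr i => B' i end).
split; [exact: small_sum|by case|].
apply/seteqP; split=> [x [[i _ Bx]|[i _ Bx]]|x [[i|i] _ Bx]].
- by exists (inl i).
- by exists (inr i).
- by left; exists i.
- by right; exists i.
Qed.

End SmallUnions.

(** * Exhaustions of algebras of sets *)

Section Filtration.
Variables (k : Ord) (X : topologicalType).
Hypothesis k_ssl : singular_strong_limit k.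
Hypothesis X_hausdorff : hausdorff_space X.
Variable base : set (set X).
Hypotheses (base_basis : basis base) (base_small : emb {U | base U} k).

Variables (I : Ord) (lev : I -> set (set X)).
Hypothesis I_nomax : nomax I.
Hypothesis I_cof : exists (D : Type) (g : D -> I), small k D /\ cofinal g.
Hypothesis lev_mono : forall i j, ole i j -> lev i `<=` lev j.
Hypothesis lev_setC : forall i, exists j, forall A, lev i A -> lev j (~` A).
Hypothesis lev_bigcup : forall i (T : Type), small k T ->
  exists j, forall A : T -> set X, (forall t, lev i (A t)) -> lev j (\bigcup_t A t).
Hypothesis lev_open : exists i, open `<=` lev i.

Let alg : set (set X) := [set A | exists i, lev i A].

(** For the members of some levels of the hierarchy this expresses that the
   ambiguous class of the next level brings nothing new. *)
Hypothesis alg_ambiguous : forall A,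
  small_unions k alg A -> small_unions k alg (~` A) -> alg A.

Let lev_bigcap i (T : Type) : small k T ->
  exists j, forall A : T -> set X, (forall t, lev i (A t)) -> lev j (\bigcap_t A t).
Proof.
move=> sT; have [j1 cj1] := lev_setC i; have [j2 uj2] := lev_bigcup j1 sT.
have [j3 cj3] := lev_setC j2; exists j3 => A lA.
rewrite -[X in lev _ X]setCK setC_bigcap; apply/cj3/uj2 => t; exact/cj1/lA.
Qed.

Let lev_setI i : exists j, forall A B, lev i A -> lev i B -> lev j (A `&` B).
Proof.
have [j ij] := lev_bigcap i (small_bool k_ssl); exists j => A B lA lB.
have -> : A `&` B = \bigcap_b (if b then A else B).
  apply/seteqP; split=> [x [Ax Bx] [] //|x h]; split; first exact: (h true).
  exact: (h false).
by apply: ij => -[].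
Qed.

Let algC A : alg A -> alg (~` A).
Proof. by move=> [i lA]; have [j ij] := lev_setC i; exists j; apply: ij. Qed.

Let algI A B : alg A -> alg B -> alg (A `&` B).
Proof.
move=> [i lA] [j lB]; have [m [im jm]] := ole_max i j; have [n mn] := lev_setI m.
by exists n; apply: mn; [exact: lev_mono lA|exact: lev_mono lB].
Qed.

Let algD A B : alg A -> alg B -> alg (A `\` B).
Proof. by move=> aA aB; rewrite setDE; apply/algI/algC. Qed.

Let alg_open U : open U -> alg U.
Proof. by move=> oU; have [i oi] := lev_open; exists i; apply: oi. Qed.

Let alg0 : alg set0.
Proof. exact/alg_open/open0. Qed.

Let tame (A : set X) := exists i, forall C, alg C -> C `<=` A -> lev i C.

Let tame_sub A B : A `<=` B -> tame B -> tame A.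
Proof.
by move=> AB [i iB]; exists i => C aC CA; apply: iB => //; apply: subset_trans AB.
Qed.

Let tame_cut O A : alg O -> tame (A `&` O) -> tame (A `\` O) -> tame A.
Proof.
move=> aO [i iO] [j jO]; have [m [im jm]] := ole_max i j.
have [n mn] := lev_bigcup m (small_bool k_ssl); exists n => C aC CA.
have -> : C = \bigcup_b (if b then C `&` O else C `\` O).
  apply/seteqP; split=> [x Cx|x [[] _ []//]].
  by have [Ox|nOx] := pselect (O x); [exists true|exists false].
apply: mn => -[].
  by apply: (lev_mono im); apply: iO; [exact: algI|exact: setSI].
by apply: (lev_mono jm); apply: jO; [exact: algD|exact: setSD].
Qed.

(** The complement of the union is also a small union, of the remainders of the
   [A j] and of the complement of their union, so that [alg_ambiguous] applies. *)
Let alg_subfamily J (A C : J -> set X) : small k J -> (forall j, alg (A j)) ->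
  (forall j j' x, A j x -> A j' x -> j = j') -> alg (~` \bigcup_j A j) ->
  (forall j, alg (C j)) -> (forall j, C j `<=` A j) -> alg (\bigcup_j C j).
Proof.
move=> sJ aA dA aR aC CA; apply: alg_ambiguous.
  exact: small_unions_bigcup.
exists (option J), (fun j => if j is Some i then A i `\` C i else ~` \bigcup_j A j).
split; [exact: small_option|by case=> // j; apply: algD|].
apply/seteqP; split=> [x nCx|x [[i|] _ /=]].
- have [[i _ Ax]|nA] := pselect ((\bigcup_j A j) x); last by exists None.
  by exists (Some i) => //; split=> // Cx; apply: nCx; exists i.
- by move=> [Ax nCx] [j _ Cx]; apply: nCx; rewrite (dA _ _ _ Ax (CA _ _ Cx)).
by move=> nA [j _ /CA Ax]; apply: nA; exists j.
Qed.

(** Diagonalization: choose below [A d] a set [C d] which appears later than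
   both the stage [g d] and the stage of [A d]. The union of the [C d] appears
   by some stage [g d], but cutting it with [A d] gives [C d]. *)
Let no_wild_family D (g : D -> I) (A : D -> set X) : small k D -> cofinal g ->
  (forall d, alg (A d)) -> (forall d d' x, A d x -> A d' x -> d = d') ->
  alg (~` \bigcup_d A d) -> (forall d, ~ tame (A d)) -> False.
Proof.
move=> sD gcof aA dA aR wA.
have /choice[stage la] := aA; have /choice[cap capP] := lev_setI.
have /choice[m mP] d := ole_max (stage d) (g d).
have /choice[C CP] d : exists C, [/\ alg C, C `<=` A d & ~ lev (cap (m d)) C].
  have /forallNP/(_ (cap (m d)))/existsNP[C /not_implyP[aC /not_implyP[CA nC]]] := wA d.
  by exists C.
have [i lC] : alg (\bigcup_d C d).
  by apply: (alg_subfamily sD aA) => // d; have [] := CP d.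
have [d id_] := gcof i; have [_ CA] := CP d; apply.
have -> : C d = (\bigcup_d C d) `&` A d.
  apply/seteqP; split=> [x Cx|x [[d' _ Cx] Ax]]; first by split; [exists d|exact: CA].
  have [_ CA' _] := CP d'; by rewrite (dA _ _ _ Ax (CA' _ Cx)).
apply: capP; last exact: lev_mono (mP d).1 _ (la d).
by apply: lev_mono lC; apply: ole_trans (mP d).2.
Qed.

(** Otherwise the stages needed for the [A j] are cofinal, and [cofinal_split]
   distributes the [A j] into cofinally many wild unions. *)
Let tame_bigcup J (A : J -> set X) : small k J ->
  (forall j, alg (A j)) -> (forall j j' x, A j x -> A j' x -> j = j') ->
  alg (~` \bigcup_j A j) -> (forall j, tame (A j)) -> tame (\bigcup_j A j).
Proof.
move=> sJ aA dA aR tA; pose bound i j := forall C, alg C -> C `<=` A j -> lev i C.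
have /choice[h hP] j : exists i, bound i j /\ forall i', bound i' j -> ole i i'.
  have [i bi imin] := @ole_least I [set i | bound i j] (tA j).
  by exists i.
have [hcof|/not_cofinal[i hi]] := pselect (cofinal h); last first.
  have [i' ii'] := lev_bigcup i sJ; exists i' => C aC CA.
  have -> : C = \bigcup_j (C `&` A j) by rewrite -setI_bigcupr; apply/esym/setIidPl.
  apply: ii' => j; apply: (lev_mono (oltW (hi j))); apply: (hP j).1.
    exact: algI.
  by move=> x [].
have [D [g [N [gcof DJ dN Ncof]]]] := cofinal_split I_nomax hcof.
have sub_alg (S : set J) : alg (\bigcup_(j in S) A j).
  have -> : \bigcup_(j in S) A j = \bigcup_j [set x | S j /\ A j x].
    by apply/seteqP; split=> [x [j Sj Ax]|x [j _ [Sj Ax]]]; exists j.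
  apply: (alg_subfamily sJ aA) => // j; last by move=> x [].
  have [Sj|nSj] := pselect (S j).
    by rewrite (_ : [set x | _] = A j) //; apply/seteqP; split=> [x []|].
  by rewrite (_ : [set x | _] = set0) //; apply/seteqP; split=> [x []|].
exfalso; apply: (@no_wild_family D g (fun l => \bigcup_(j in N l) A j)) => //.
- exact: small_emb DJ sJ.
- by move=> l l' x [j Nj Ax] [j' Nj' Ax']; apply: dN Nj _; rewrite (dA _ _ _ Ax Ax').
- apply: algC; have := sub_alg (\bigcup_l N l).
  rewrite (_ : \bigcup_(j in \bigcup_l N l) A j = \bigcup_l \bigcup_(j in N l) A j) //.
  apply/seteqP; split=> [x [j [l _ Nj] Ax]|x [l _ [j Nj Ax]]].
    by exists l => //; exists j.
  by exists j => //; exists l.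
move=> l [i ti]; have [i' ii'] := I_nomax.2 i; have [j Nj ij] := Ncof l i'.
apply: (@olt_irrefl I i); apply: olt_le_trans ii' (ole_trans ij _).
apply: (hP j).2 => C aC CA; apply: ti => // x /CA Ax; by exists j.
Qed.

Let alg_pattern J (V : J -> set X) (s : J -> Prop) : small k J ->
  (forall j, open (V j)) -> alg [set x | forall j, V j x <-> s j].
Proof.
move=> sJ oV; have [i oi] := lev_open; have [i' ci] := lev_setC i.
have [m [im i'm]] := ole_max i i'; have [n mn] := lev_bigcap m sJ.
exists n; have -> : [set x | forall j, V j x <-> s j] =
    \bigcap_j (if pselect (s j) then V j else ~` V j).
  apply/seteqP; split=> x Vx j; last by have := Vx j Logic.I; case: pselect.
  by move=> _; case: pselect => sj; [exact/Vx|move/Vx].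
apply: mn => j; case: (pselect (s j)) => sj; first exact/(lev_mono im)/oi.
exact/(lev_mono i'm)/ci/oi.
Qed.

(** The regions of the Venn diagram of the [V j] are small in number and disjoint;
   those that meet the union of the [V j] make it up. *)
Let tame_bigcup_open J (V : J -> set X) E : small k J -> alg E ->
  (forall j, open (V j)) -> (forall j, tame (E `&` V j)) -> tame (E `&` \bigcup_j V j).
Proof.
move=> sJ aE oV tV.
pose A (s : {s : J -> bool | exists j, s j}) :=
  E `&` [set x | forall j, V j x <-> sval s j].
have AE : \bigcup_s A s = E `&` \bigcup_j V j.
  apply/seteqP; split=> [x [[s [j sj]] _ [Ex /= Vs]]|x [Ex [j _ Vx]]].
    by split=> //; exists j => //; apply/Vs.
  have sP : exists j, `[< V j x >] by exists j; apply/asboolP.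
  exists (exist _ (fun j => `[< V j x >]) sP) => //; split=> // i /=.
  by split=> /asboolP.
rewrite -AE; apply: tame_bigcup.
- exact: small_emb (emb_sub _) (small_powerset k_ssl sJ).
- by move=> s; apply: algI => //; apply: alg_pattern.
- move=> s s' x [_ xs] [_ xs']; apply/sval_inj/funext => j.
  by apply/idP/idP => [/xs/xs'|/xs'/xs].
- by rewrite AE; apply/algC/algI => //; apply/alg_open/bigcup_open.
move=> [s [j sj]]; apply: tame_sub (tV j) => x [Ex /= Vs]; split=> //; exact/Vs.
Qed.

Let tame_part E := \bigcup_(U in [set U | base U /\ tame (E `&` U)]) U.

Let base_open U : base U -> open U.
Proof. by case: base_basis => + _; apply. Qed.

Let tame_part_open E : open (tame_part E).
Proof. by apply: bigcup_open => U [/base_open]. Qed.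

(** The at most [k] basic open sets that are tame on [E] are grouped according
   to their rank in [k] and to the stage they need: this leaves a small family
   of open sets, which are still tame on [E]. *)
Let tame_tame_part E : alg E -> tame (E `&` tame_part E).
Proof.
move=> aE; have [e ei] := base_small; have [D [g [sD gcof]]] := I_cof.
have [W [S [sW sS cov]]] := small_exhaustion k_ssl.
pose bound d U := forall C, alg C -> C `<=` E `&` U -> lev (g d) C.
pose V (p : W * D) :=
  \bigcup_(U in [set U : {U | base U} | S p.1 (e U) /\ bound p.2 (sval U)]) sval U.
have VE : tame_part E = \bigcup_p V p.
  apply/seteqP; split=> [x [U [bU [i iU]] Ux]|x [p _ [[U bU] [_ Ubd] Ux]]].
    have [d id_] := gcof i; have [w Sw] := cov (e (exist _ U bU)).
    exists (w, d) => //; exists (exist _ U bU) => //; split=> // C aC CU.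
    exact/(lev_mono id_)/iU.
  by exists U => //; split=> //; exists (g p.2).
rewrite VE; apply: tame_bigcup_open => //; first exact: small_prod.
  by move=> p; apply: bigcup_open => U _; apply: base_open (svalP U).
move=> [w d]; pose T := {U : {U | base U} | S w (e U) /\ bound d (sval U)}.
have sT : small k T.
  apply: small_emb (sS w); exists (fun U : T => exist (S w) (e (sval U)) (svalP U).1).
  by move=> U U' [/ei/sval_inj].
have [j dj] := lev_bigcup (g d) sT; exists j => C aC CV.
have -> : C = \bigcup_(U : T) (C `&` sval (sval U)).
  apply/seteqP; split=> [x Cx|x [U _ []//]].
  by have [_ [U Ubd Ux]] := CV _ Cx; exists (exist _ U Ubd).
apply: dj => -[[U bU] [SU Ubd]] /=; apply: Ubd.
  exact/algI/alg_open/base_open.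
by move=> x [Cx Ux]; have [Ex _] := CV _ Cx.
Qed.

Let tame_point E : (forall x y, E x -> E y -> x = y) -> tame E.
Proof.
move=> Esub; have [i oi] := lev_open; have [i' ci] := lev_setC i.
have [m [im i'm]] := ole_max i i'; exists m => C _ CE.
have [[x Cx]|nC] := pselect (C !=set0); last first.
  have -> : C = set0 by apply/seteqP; split=> // x Cx; apply: nC; exists x.
  exact/(lev_mono im)/oi/open0.
have -> : C = ~` ~` [set x].
  rewrite setCK; apply/seteqP; split=> [y Cy|_ ->//].
  by apply: Esub; apply: CE.
apply/(lev_mono i'm)/ci/oi; rewrite openC.
exact/accessible_closed_set1/hausdorff_accessible.
Qed.

(** The points all of whose neighbourhoods are wild on [E] make up a wild part
   of [E], hence there are two of them; they have disjoint neighbourhoods. *)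
Let wild_split E : alg E -> ~ tame E ->
  exists U, [/\ open U, ~ tame (E `&` U) & ~ tame (E `\` U)].
Proof.
move=> aE wE.
have [x [y [[Ex nx] [Ey ny] xy]]] : exists x y,
    [/\ (E `\` tame_part E) x, (E `\` tame_part E) y & x <> y].
  apply: contrapT => nxy; apply: wE; apply: (tame_cut _ (tame_tame_part aE)).
    exact/alg_open/tame_part_open.
  apply: tame_point => x y Ex Ey; apply: contrapT => xy.
  by apply: nxy; exists x, y.
have wild_nbhs z U : ~ tame_part E z -> open U -> U z -> ~ tame (E `&` U).
  move=> nz oU Uz tU; apply: nz.
  have [V [bV Vz] VU] : filter_from [set U | base U /\ U z] id U.
    by apply: base_basis.2; apply: open_nbhs_nbhs.
  exists V => //; split=> //; apply: tame_sub tU; exact: setIS.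
move: X_hausdorff; rewrite open_hausdorff => /(_ x y)[|[U V] /=]; first exact/eqP.
rewrite !inE => -[Ux Vy] [oU oV UV0]; exists U; split=> //.
  exact: wild_nbhs oU Ux.
move=> tU; apply: (wild_nbhs y V) => //; apply: tame_sub tU => z [Ez Vz]; split=> // Uz.
by have /seteqP[/(_ z (conj Uz Vz))] := UV0.
Qed.

(** Splitting [X] repeatedly, along a small well-order with a cofinal map to the
   stages, leaves at most [2 ^ D] cells; they cannot all be tame, and the sets
   split off on the way to a wild cell are wild. *)
Let tame_setT : tame setT.
Proof.
apply: contrapT => wT; have [D [g0 [sD g0cof]]] := I_cof.
have [o [c [csurj oD _]]] := initial_order D; have so := small_emb oD sD.
pose g := g0 \o c; have gcof : cofinal g.
  move=> i; have [d id_] := g0cof i; have [t ct] := csurj d.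
  by exists t; rewrite /g /= ct.
have /choice[sp spP] E : exists U, open U /\
    (alg E -> ~ tame E -> ~ tame (E `&` U) /\ ~ tame (E `\` U)).
  have [[aE wE]|n] := pselect (alg E /\ ~ tame E).
    by have [U [oU ? ?]] := wild_split aE wE; exists U.
  by exists set0; split; [exact: open0|move=> aE wE; case: n].
(* [cell x d U] is the part of [x] after the cuts before [d], and [sp] of it is
   the next cut; [E x] below is the part of [x] after all the cuts *)
pose cell x d (U : o -> set X) := [set y | forall d', olt d' d -> (U d' y <-> U d' x)].
have [U UE] : exists U : X -> o -> set X, forall x d, U x d = sp (cell x d (U x)).
  pose step x (d : o) (U : forall d', olt d' d -> set X) :=
    sp [set y | forall d' (h : olt d' d), U d' h y <-> U d' h x].
  exists (fun x => Fix (@olt_wf o) (fun=> set X) (step x)) => x d.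
  rewrite Fix_eq // => {}d U U' UU'; congr (step _ _ _).
  by apply: functional_extensionality_dep => d'; apply/funext => h.
have U_open x d : open (U x d) by rewrite UE; have [] := spP (cell x d (U x)).
pose E x := [set y | forall d, U x d y <-> U x d x].
(* points that lie on the same side of each cut undergo the same cuts; this is
   used both for [y] in [E x] and for points with the same sequence of sides *)
have U_eq x y : (forall d, U x d = U y d -> (U x d x <-> U y d y)) -> U x = U y.
  move=> xy; apply/funext; apply: (well_founded_ind (@olt_wf o)) => d IHd.
  rewrite !UE; congr sp; apply/seteqP.
  by split=> z zP d' d'd; have := zP _ d'd; have := xy d' (IHd _ d'd);
    rewrite (IHd _ d'd) => ->.
have E_eq x y : U x = U y -> E x y -> E x = E y.
  move=> xy Exy; apply/seteqP; split=> z zP d; have := zP d; have := Exy d;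
    by rewrite xy => ->.
have E_agree x y : E x y -> U x = U y.
  by move=> Exy; apply: U_eq => d xy; rewrite -xy; apply: iff_sym; apply: Exy.
have Exx x : E x x by [].
pose J := {A : set X | exists x, A = E x}.
have sJ : small k J.
  apply: small_emb (small_powerset k_ssl so).
  have /choice[pt ptP] (A : J) : exists x, sval A = E x by exact: svalP A.
  exists (fun A d => `[< U (pt A) d (pt A) >]) => A A' eAA'; apply: sval_inj.
  have AA' d : U (pt A) d (pt A) <-> U (pt A') d (pt A').
    have := congr1 (fun s => s d) eAA' => /= eA.
    by split=> /asboolP; [rewrite eA|rewrite -eA] => /asboolP.
  rewrite !ptP; have UU := U_eq _ _ (fun d _ => AA' d).
  by apply: E_eq => // d; rewrite {1}UU; apply: iff_sym.
have EJ : \bigcup_(A : J) sval A = setT.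
  apply/seteqP; split=> // x _.
  by exists (exist _ (E x) (ex_intro _ x erefl)).
have [x wE] : exists x, ~ tame (E x).
  apply: contrapT => /forallNP tE; apply: wT; rewrite -EJ.
  apply: tame_bigcup => //.
  - by move=> A; have [x ->] := svalP A; apply: alg_pattern.
  - move=> A A' y Ay A'y; apply: sval_inj.
    have [x xA] := svalP A; have [x' x'A'] := svalP A'; rewrite xA x'A' in Ay A'y *.
    by rewrite (E_eq _ _ (E_agree _ _ Ay) Ay) (E_eq _ _ (E_agree _ _ A'y) A'y).
  - by rewrite EJ setCT; apply: alg0.
  - by move=> A; have [x ->] := svalP A; apply: contrapT (tE x).
pose C d := cell x d (U x).
have aC d : alg (C d).
  have := @alg_pattern (seg d) (fun d' => U x (sval d')) (fun d' => U x (sval d') x) _ _.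
  rewrite (_ : [set _ | _] = C d); first by apply => //; apply: small_emb (emb_seg d) so.
  apply/seteqP; split=> y yP d'; last by apply: yP; apply: (svalP d').
  by move=> d'd; apply: (yP (in_seg d'd)).
have wC d : ~ tame (C d).
  by move=> tC; apply: wE; apply: tame_sub tC => y Ey d' _; apply: Ey.
(* the side of the cut of [C d] that does not contain [x] *)
pose A d := C d `&` [set y | ~ (U x d y <-> U x d x)].
apply: (@no_wild_family o g A) => //.
- move=> d; apply: algI => //; have [Ux|nUx] := pselect (U x d x).
    rewrite (_ : [set _ | _] = ~` U x d); first exact/algC/alg_open.
    by apply/seteqP; split=> y /= h; [move=> Uy; apply: h|move=> [_ /(_ Ux)]].
  rewrite (_ : [set _ | _] = U x d); first exact/alg_open.
  apply/seteqP; split=> y /= h; last by move=> [/(_ h)].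
  by apply: contrapT => nUy; apply: h.
- move=> d d' y [Cd nd] [Cd' nd']; apply: contrapT => /olt_neq[dd'|d'd].
    by apply: nd; apply: Cd'.
  by apply: nd'; apply: Cd.
- rewrite (_ : ~` _ = E x); first exact: alg_pattern.
  apply/seteqP; split=> y yP; last by move=> [d _ [_]]; apply; apply: yP.
  apply: (well_founded_ind (@olt_wf o)) => d IHd; apply: contrapT => nd.
  by apply: yP; exists d.
move=> d tA; have [_ /(_ (aC d) (wC d))[wCU wCD]] := spP (C d).
have [Ux|nUx] := pselect (U x d x).
  apply: wCD; apply: tame_sub tA => y [Cy]; rewrite -[sp _]UE => nUy; split=> //.
  by move=> [_ /(_ Ux)].
apply: wCU; apply: tame_sub tA => y [Cy]; rewrite -[sp _]UE => Uy; split=> //.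
by move=> [/(_ Uy)].
Qed.

(** The whole space is tame, which bounds the stages of all the members at once. *)
Theorem exhaustion_stationary : exists i, forall A, alg A -> lev i A.
Proof. by have [i ti] := tame_setT; exists i => A aA; apply: ti. Qed.

End Filtration.

(** * The hierarchy *)

Lemma one_le_add (c : Ord) : (ord_nat 1 <= ord_nat 1 + c)%Ord.
Proof.
have [[z]|c0] := pselect (inhabited c); first by left; apply: ord_lt_add z.
by right; apply: ord_add_empty => z; apply: c0.
Qed.

Lemma ord_lt_succ (b c : Ord) : (b < c + ord_nat 1)%Ord -> (b <= c)%Ord.
Proof.
move=> /ord_ltP[[x|x] bx]; last first.
  right; apply: ord_iso_trans bx _; rewrite (ord1_eq x); exact: seg_add1_top.
left; apply: ord_iso_lt (ord_iso_sym _) (ord_iso_refl _) (seg_lt x).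
exact: ord_iso_trans bx (seg_add_inl _ _).
Qed.

Lemma ord_succ_lt (c : Ord) : (c < c + ord_nat 1)%Ord.
Proof. exact: ord_lt_add (nat_ord_elt (ltnSn 0)). Qed.

Lemma ord_ind (P : Ord -> Prop) : (forall a b, ord_iso a b -> P a -> P b) ->
  (forall a : Ord, (forall z : a, P (seg z)) -> P a) -> forall a, P a.
Proof.
move=> Piso Pind a; apply: (Pind); apply: (well_founded_ind (@olt_wf a)) => z IHz.
apply: (Pind) => s; apply: Piso (ord_iso_sym (seg_seg s)) _.
by apply: IHz; apply: (svalP s).
Qed.

Definition unions_over T V (C : set (set T)) : set (set T) :=
  [set A | exists2 B : V -> set T, forall v, C (B v) & A = \bigcup_v B v].

Lemma unions_over_emb T V V' (C : set (set T)) :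
  C set0 -> emb V V' -> unions_over V C `<=` unions_over V' C.
Proof.
move=> C0 [e ei] _ [B CB ->].
have /choice[B' B'P] v' : exists S, [/\ C S, forall v, e v = v' -> S = B v
    & forall x, S x -> exists v, B v x].
  have [[v <-]|nv] := pselect (exists v, e v = v').
    by exists (B v); split=> // [w /ei->//|x Bx]; exists v.
  by exists set0; split=> // v ev; case: nv; exists v.
exists B' => [v'|]; first by have [] := B'P v'.
apply/seteqP; split=> [x [v _ Bx]|x [v' _ B'x]].
  by exists (e v) => //; have [_ /(_ v erefl)-> _] := B'P (e v).
by have [_ _ /(_ _ B'x)[v Bx]] := B'P v'; exists v.
Qed.

Section Hierarchy.
Variables (k : Ord) (X : topologicalType).
Hypothesis k_ssl : singular_strong_limit k.
Hypothesis X_open : exists2 V, small k V & open `<=` unions_over V (@closed X).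
Local Notation sunions := (small_unions k).

Lemma small_unions_over V (C : set (set X)) : small k V -> unions_over V C `<=` sunions C.
Proof. by move=> sV _ [B CB ->]; exists V, B. Qed.

Let kunions (C : set (set X)) : set (set X) :=
  [set A | exists (J : Type) (B : J -> set X),
    [/\ emb J k, forall j, C (B j) & A = \bigcup_j B j]].

Let small_unions_sub_kunions (C : set (set X)) : sunions C `<=` kunions C.
Proof. by move=> _ [J [B [/small_self Jk CB ->]]]; exists J, B. Qed.

Let small_unions_kunions (C : set (set X)) : sunions (kunions C) `<=` kunions C.
Proof.
move=> _ [J [B [sJ CB ->]]].
have /choice[T TP] j : exists T : {T : Type & T -> set X},
    [/\ emb (tag T) k, forall t, C (tagged T t) & B j = \bigcup_t tagged T t].
  by have [T [B' ?]] := CB j; exists (existT _ T B').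
exists {j & tag (T j)}, (fun p => tagged (T (tag p)) (tagged p)); split.
- apply: emb_sum_self => // [|j]; first exact: small_self; by have [] := TP j.
- by move=> [j t] /=; have [_ + _] := TP j; apply.
apply/seteqP; split=> [x [j _]|x [[j t] _ /= Tx]].
  by have [_ _ ->] := TP j => -[t _ Tx]; exists (existT _ j t).
by exists j => //; have [_ _ ->] := TP j; exists t.
Qed.

(** As [k] is singular, a union of [k] sets is a union of fewer than [k] small
    unions. *)
Let regroup : exists2 W, small k W &
  forall C, kunions C `<=` unions_over W (sunions C).
Proof.
have [W [S [sW sS cov]]] := small_exhaustion k_ssl.
exists W => // C _ [J [B [[e ei] CB ->]]].
exists (fun w => \bigcup_(j : {j | S w (e j)}) B (sval j)) => [w|].
  apply: small_unions_bigcup => //; apply: small_emb (sS w).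
  exists (fun j : {j | S w (e j)} => exist (S w) (e (sval j)) (svalP j)).
  by move=> j j' [/ei/sval_inj].
apply/seteqP; split=> [x [j _ Bx]|x [w _ [j _ Bx]]]; last by exists (sval j).
by have [w Sw] := cov (e j); exists w => //; exists (exist _ j Sw).
Qed.

(** With this indexing the levels start at [0], and it is the parity of [c] that
   decides how the classes behave. *)
Definition Sig c : set (set X) := kSigma k X (ord_nat 1 + c)%Ord.
Definition Pi c : set (set X) := kPi k X (ord_nat 1 + c)%Ord.
Definition Pi_below (c : Ord) : set (set X) := [set A | exists z : c, Pi (seg z) A].

Lemma PiE c : Pi c = [set A | Sig c (~` A)].
Proof. by []. Qed.

Lemma PiC c A : Pi c (~` A) <-> Sig c A.
Proof. by rewrite PiE /= setCK. Qed.

Lemma kSigma_iso a b A : ord_iso a b -> kSigma k X a A -> kSigma k X b A.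
Proof.
move=> + kA; case: kA => [{}a U a1 oU|{}a d c {}A a1 dk c1 ca kA] ab.
  by apply: kSigma_open => //; apply: ord_iso_trans (ord_iso_sym ab) a1.
apply: (kSigma_bigcup (b := c)) => //; first exact: ord_iso_lt (ord_iso_refl _) ab a1.
by move=> i; apply: ord_iso_lt (ord_iso_refl _) ab (ca i).
Qed.

Lemma Sig_iso a b : ord_iso a b -> Sig a = Sig b.
Proof.
move=> ab; have ab1 := ord_add_iso (ord_iso_refl (ord_nat 1)) ab.
by apply/seteqP; split=> A; apply: kSigma_iso => //; apply: ord_iso_sym.
Qed.

Lemma Pi_iso a b : ord_iso a b -> Pi a = Pi b.
Proof. by move=> /Sig_iso ab; rewrite !PiE ab. Qed.

(** The recursion on the level, freed from the choice of the representatives of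
   the ordinals and from the well-order of the index of the union. *)
Lemma SigE (c : Ord) A : Sig c A <->
  ((c -> False) /\ open A) \/ (inhabited c /\ sunions (Pi_below c) A).
Proof.
split=> [kA|[[c0 oA]|[[z0] [J [B [sJ CB ->]]]]]].
- suff gen a B : kSigma k X a B -> ord_iso a (ord_nat 1 + c)%Ord ->
      ((c -> False) /\ open B) \/ (inhabited c /\ sunions (Pi_below c) B).
    by apply: gen kA (ord_iso_refl _).
  case=> {kA a A B}.
    move=> a U a1 oU ac; left; split=> // z; apply: (@ord_lt_irrefl (ord_nat 1)).
    apply: ord_lt_le_trans (ord_lt_add _ z) _; right.
    exact: ord_iso_trans (ord_iso_sym ac) a1.
  move=> a d b A a1 dk b1 ba kA ac; right; split.
    apply: contrapT => c0; apply: (@ord_lt_irrefl (ord_nat 1)).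
    apply: ord_lt_le_trans a1 _; right; apply: ord_iso_trans ac (ord_iso_sym _).
    by apply: ord_add_empty => z; apply: c0.
  exists d, A; split=> //; first exact: small_lt.
  move=> i; have [|z bz] := one_le_lt_add (b1 i) (c := b i) (a := c).
    exact: ord_iso_lt (ord_iso_refl _) ac (ba i).
  by exists z; apply: kSigma_iso bz (kA i).
- by apply: kSigma_open => //; apply/ord_iso_sym/ord_add_empty.
have one_lt : (ord_nat 1 < ord_nat 1 + c)%Ord by apply: ord_lt_add z0.
have [[j0]|J0] := pselect (inhabited J); last first.
  (* [seg m] represents [0] as an ordinal below [k] *)
  have [s _] := sJ; have [m _ mmin] := @ole_least k setT (ex_intro _ s Logic.I).
  pose d := seg m; have d0 : d -> False by move=> [x /oltNge]; apply; apply: mmin.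
  rewrite (_ : \bigcup_j B j = \bigcup_(i : d) set0).
    by apply: (kSigma_bigcup (b := fun=> ord_nat 1)) => //;
      [exact: seg_lt|..] => i; case: (d0 i).
  by apply/seteqP; split=> [x [j]|x [i]]; [case: J0|case: (d0 i)].
have [s Js] := sJ; have [f fsurj] := emb_surj j0 Js.
have /choice[z zP] := CB.
rewrite (_ : \bigcup_j B j = \bigcup_(i : seg s) B (f i)).
  apply: (kSigma_bigcup (b := fun i => (ord_nat 1 + seg (z (f i)))%Ord)) => //.
  - exact: seg_lt.
  - by move=> i; apply: one_le_add.
  - by move=> i; apply/ord_lt_add2l/seg_lt.
  - by move=> i; apply: zP.
apply/seteqP; split=> [x [j _ Bx]|x [i _ Bx]]; last by exists (f i).
by have [i fi] := fsurj j; exists i; rewrite ?fi.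
Qed.

Lemma Sig_empty (c : Ord) : (c -> False) -> Sig c = open.
Proof.
move=> c0; apply/seteqP; split=> A; last by move=> oA; apply/SigE; left.
by move=> /SigE[[]|[[/c0]]].
Qed.

Lemma Sig_inhabited (c : Ord) : inhabited c -> Sig c = sunions (Pi_below c).
Proof.
move=> c0; apply/seteqP; split=> A; last by move=> UA; apply/SigE; right.
by move=> /SigE[[c1]|[]] //; case: c0 => /c1.
Qed.

Lemma Pi_below_lt (b c : Ord) : (b < c)%Ord -> Pi b `<=` Pi_below c.
Proof. by move=> /ord_ltP[z /Pi_iso-> A]; exists z. Qed.

Lemma Pi_below_mono (b c : Ord) : (b < c)%Ord -> Pi_below b `<=` Pi_below c.
Proof.
move=> bc A [z PA]; apply: (Pi_below_lt (b := seg z)) PA.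
exact: ord_lt_trans (seg_lt z) bc.
Qed.

Lemma Pi_sub_Sig (b c : Ord) : (b < c)%Ord -> Pi b `<=` Sig c.
Proof.
move=> bc A PA; rewrite Sig_inhabited; last exact: ord_lt_nonempty bc.
exact/(small_unionsW k_ssl)/(Pi_below_lt bc).
Qed.

(** The only case that needs an argument is [b = 0], where the hypothesis on open
   sets is used. *)
Lemma Sig_mono (b c : Ord) : (b < c)%Ord -> Sig b `<=` Sig c.
Proof.
move=> bc A; rewrite (@Sig_inhabited c); last exact: ord_lt_nonempty bc.
have [b0|nb] := pselect (inhabited b).
  by rewrite Sig_inhabited //; apply: sub_small_unions; apply: Pi_below_mono.
have b0 : b -> False by move=> x; apply: nb.
have [V sV oV] := X_open; rewrite Sig_empty // => oA.
have /(sub_small_unions _) := small_unions_over sV (oV _ oA); apply => F cF.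
apply: (Pi_below_lt bc).
by rewrite PiE /= Sig_empty // openC.
Qed.

Lemma Pi_mono (b c : Ord) : (b < c)%Ord -> Pi b `<=` Pi c.
Proof. by move=> bc A; apply: Sig_mono. Qed.

Lemma Sig_sub_Pi (b c : Ord) : (b < c)%Ord -> Sig b `<=` Pi c.
Proof. by move=> bc A SA; apply: Pi_sub_Sig bc _ _; apply/PiC. Qed.

Lemma open_sub_Sig c : open `<=` Sig c.
Proof.
move=> U oU; have [[z]|nc] := pselect (inhabited c); last first.
  by rewrite Sig_empty // => z; apply: nc.
apply: (@Sig_mono (ord_nat 0)); last by rewrite Sig_empty // => /ord_nat0_empty.
have [m _ mmin] := @ole_least c setT (ex_intro _ z Logic.I).
apply/ord_ltP; exists m; apply: ord_iso_empty => [/ord_nat0_empty//|[x /oltNge]].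
by apply; apply: mmin.
Qed.

Lemma Pi_set0 c : Pi c set0.
Proof. by apply: open_sub_Sig; rewrite setC0; apply: openT. Qed.

Lemma Sig_succ c : Sig (c + ord_nat 1)%Ord = sunions (Pi c).
Proof.
rewrite Sig_inhabited; last exact: ord_lt_nonempty (ord_succ_lt c).
apply/seteqP; split; apply: sub_small_unions => A; last first.
  exact/Pi_below_lt/ord_succ_lt.
move=> [z PA]; have [zc|/Pi_iso <-//] := ord_lt_succ (seg_lt z).
exact: Pi_mono zc _ PA.
Qed.

(** What the parity of the level is used for. It matters that [V] is common to all
   the sets of the level: the functions from a small type to [V] are small. *)
Definition even_level c := sunions (Sig c) `<=` Sig c /\
  exists2 V, small k V & Sig c `<=` unions_over V (Pi c).

Lemma even_level_iso a b : ord_iso a b -> even_level a -> even_level b.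
Proof. by move=> ab; rewrite /even_level (Sig_iso ab) (Pi_iso ab). Qed.

Lemma even_level0 (c : Ord) : (c -> False) -> even_level c.
Proof.
move=> c0; have [V sV oV] := X_open; rewrite /even_level Sig_empty //; split.
  by move=> _ [J [B [_ oB ->]]]; apply: bigcup_open => j _; apply: oB.
exists V => // U /oV[B cB ->]; exists B => // v.
by rewrite PiE /= Sig_empty // openC.
Qed.

(** The sets in a union of at most [k] sets of lower levels are grouped by their
   rank in [k] and by a small cofinal set of levels. *)
Lemma even_level_limit (c : Ord) : nomax c -> emb c k -> even_level c.
Proof.
move=> c_nomax ck; have [D [g [sD gcof]]] := small_cofinal k_ssl c_nomax ck.
have [W [S [sW sS cov]]] := small_exhaustion k_ssl.
have key : kunions (Pi_below c) `<=` unions_over (W * D) (Pi_below c).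
  move=> _ [J [B [[e ei] CB ->]]]; have /choice[z zP] := CB.
  pose T (p : W * D) := {j | S p.1 (e j) /\ ole (z j) (g p.2)}.
  exists (fun p => \bigcup_(j : T p) B (sval j)) => [[w d]|]; last first.
    apply/seteqP; split=> [x [j _ Bx]|x [p _ [j _ Bx]]]; last by exists (sval j).
    have [w Sw] := cov (e j); have [d zd] := gcof (z j).
    by exists (w, d) => //; exists (exist _ j (conj Sw zd)).
  have [y gy] := c_nomax.2 (g d); have [y' yy'] := c_nomax.2 y.
  exists y'; apply: Sig_sub_Pi (seg_mono yy') _ _.
  rewrite Sig_inhabited; last by split; exact: in_seg gy.
  apply: small_unions_bigcup => [|[j [Sj zj]] /=].
    apply: small_emb (sS w).
    exists (fun j : T (w, d) => exist (S w) (e (sval j)) (svalP j).1).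
    by move=> j j' [/ei/sval_inj].
  apply: (Pi_below_lt (b := seg (z j))); last exact: zP.
  exact/seg_mono/(ole_lt_trans zj).
have c0 := c_nomax.1; rewrite /even_level; split; last first.
  exists (W * D)%type; first exact: small_prod.
  move=> A; rewrite Sig_inhabited // => /small_unions_sub_kunions/key[B BP ->].
  by exists B => // p; have [z] := BP p; apply/Pi_mono/seg_lt.
rewrite Sig_inhabited // => A UA; apply: (@small_unions_over (W * D)%type).
  exact: small_prod.
apply/key/small_unions_kunions; apply: sub_small_unions UA.
exact: small_unions_sub_kunions.
Qed.

(** Distributivity: the complement of a union of [J] sets of [Pi c] is an
   intersection of [J] unions of [V] sets, hence a union, over the functions
   from [J] to [V], of small intersections. *)
Lemma even_level_setC c J : even_level c -> small k J -> exists2 J', small k J' &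
  forall A, unions_over J (Pi c) A -> unions_over J' (Pi c) (~` A).
Proof.
move=> [cU [V sV VP]] sJ; exists (J -> V); first exact: small_fun.
move=> _ [B PB ->].
have /choice[D DP] j : exists D : V -> set X,
    (forall v, Pi c (D v)) /\ ~` B j = \bigcup_v D v.
  by have [D ? ?] := VP _ (PB j); exists D.
exists (fun f => \bigcap_j D j (f j)) => [f|].
  rewrite PiE /= setC_bigcap; apply: cU; apply: small_unions_bigcup => // j.
  exact: (DP j).1.
rewrite setC_bigcup; apply/seteqP; split=> [x nBx|x [f _ Dx] j _]; last first.
  by rewrite (DP j).2; exists (f j) => //; apply: Dx.
have /choice[f fP] j : exists v, D j v x.
  by have := nBx j Logic.I; rewrite (DP j).2 => -[v _ Dx]; exists v.
by exists f.
Qed.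

Lemma Sig_succ_even c : even_level c -> Sig (c + ord_nat 1)%Ord = Pi (c + ord_nat 1)%Ord.
Proof.
move=> ec; have SC A : Sig (c + ord_nat 1)%Ord A -> Sig (c + ord_nat 1)%Ord (~` A).
  rewrite Sig_succ => -[J [B [sJ PB AE]]].
  have [J' sJ' J'P] := even_level_setC ec sJ.
  by apply: (small_unions_over sJ'); apply: J'P; exists B.
apply/seteqP; split=> A; first exact: SC.
by move=> /SC; rewrite setCK.
Qed.

Lemma Sig_succ2_even c : even_level c ->
  Sig (c + ord_nat 1 + ord_nat 1)%Ord = sunions (sunions (Pi c)).
Proof. by move=> ec; rewrite Sig_succ -Sig_succ_even // Sig_succ. Qed.

(** All these iterated small unions of sets of [Pi c] are unions of [k] of them,
   which are regrouped in a small union of sets of [Sig (c + 1)]. *)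
Lemma even_level_succ2 c : even_level c -> even_level (c + ord_nat 1 + ord_nat 1)%Ord.
Proof.
move=> ec; have [W sW reg] := regroup; split.
  rewrite Sig_succ2_even // => A UA; apply: (small_unions_over sW); apply: reg.
  apply/small_unions_kunions; apply: sub_small_unions UA => {}A UA.
  apply/small_unions_kunions; apply: sub_small_unions UA.
  exact: small_unions_sub_kunions.
exists W => // A; rewrite Sig_succ2_even // => UA.
have /reg[B UB ->] : kunions (Pi c) A.
  apply/small_unions_kunions; apply: sub_small_unions UA.
  exact: small_unions_sub_kunions.
exists B => // w; apply: Sig_sub_Pi (ord_succ_lt _) _ _; rewrite Sig_succ; exact: UB.
Qed.

Lemma max_or_nomax (a : Ord) : [\/ a -> False, nomax a | exists z : a, forall x, ole x z].
Proof.
have [a0|a0] := pselect (inhabited a); last by constructor 1 => z; apply: a0.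
have [amax|namax] := pselect (exists z : a, forall x, ole x z); first by constructor 3.
constructor 2; split=> // z; apply: contrapT => nz; apply: namax; exists z => x.
by apply: contrapT => /oltNge zx; apply: nz; exists x.
Qed.

Lemma even_level_or_succ (a : Ord) : emb a k ->
  even_level a \/ exists2 c, even_level c & ord_iso a (c + ord_nat 1)%Ord.
Proof.
elim/ord_ind: a => [a b ab IH bk|a IHa ak].
  have [|ea|[c ec ac]] := IH; first exact: emb_trans (ord_iso_emb ab) bk.
    by left; apply: even_level_iso ea.
  by right; exists c => //; apply: ord_iso_trans (ord_iso_sym ab) ac.
have [a0|a_nomax|[z zmax]] := max_or_nomax a.
- by left; apply: even_level0.
- by left; apply: even_level_limit.
have az := ord_max_succ zmax.
have [|ez|[c ec zc]] := IHa z; first exact: emb_trans (emb_seg z) ak.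
  by right; exists (seg z).
left; apply: even_level_iso (even_level_succ2 ec); apply: ord_iso_sym.
exact: ord_iso_trans az (ord_add_iso zc (ord_iso_refl _)).
Qed.

Lemma even_level_even (a : Ord) : emb a k -> ord_even a -> even_level a.
Proof.
move=> ak [l [n [l_lim n_even al]]]; apply: (even_level_iso (ord_iso_sym al)).
have lk : emb l k.
  apply: emb_trans ak; apply: emb_trans (ord_iso_emb (ord_iso_sym al)).
  by exists inl => x y [].
rewrite -(odd_double_half n) (negbTE n_even) add0n.
elim: n./2 => [|m IHm]; last first.
  exact: even_level_iso (ord_iso_sym (ord_add_nat2 _ _)) (even_level_succ2 IHm).
apply: even_level_iso (ord_add_empty _ ord_nat0_empty) _.
case: l_lim => [l0|/ord_limit_nomax ?]; last exact: even_level_limit.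
apply: even_level0; have [f _ _] := l0; move=> /f; exact: ord_nat0_empty.
Qed.

(** ** Levels that exhaust the Borel sets *)

Lemma kSigma_sub_kBor c : kSigma k X c `<=` kBor k X.
Proof.
move=> A; elim=> {c A} [c U _ oU|c d b A _ dk _ _ _ IH] F [[FC FU] Fo]; first exact: Fo.
have FAC i := FC _ (IH i F (conj (conj FC FU) Fo)).
by apply: FU => // i; rewrite -[A i]setCK.
Qed.

Lemma Sig_eq_kBor c : (forall A, Sig c A -> Sig c (~` A)) ->
  sunions (Sig c) `<=` Sig c -> Sig c = kBor k X.
Proof.
move=> SC SU; apply/seteqP; split; first exact: kSigma_sub_kBor.
apply: smallest_sub; last exact: open_sub_Sig.
split=> // d A dk SA; apply: SU; apply: small_unions_bigcup => //; exact: small_lt.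
Qed.

Lemma lt_kord_not_closed (a c : Ord) : (ord_nat 1 + a < kord k X)%Ord -> (c <= a)%Ord ->
  (forall A, Sig c A -> Sig c (~` A)) -> sunions (Sig c) `<=` Sig c -> False.
Proof.
move=> a_lt ca SC SU; have [_ kmin] := lt_ord_min a_lt.
apply: (@ord_lt_irrefl (ord_nat 1 + a)%Ord); apply: ord_lt_le_trans a_lt _.
have ca1 : (ord_nat 1 + c <= ord_nat 1 + a)%Ord.
  case: ca => [ca|ca]; first by left; apply: ord_lt_add2l.
  by right; apply: ord_add_iso => //; apply: ord_iso_refl.
have : (kord k X <= ord_nat 1 + c)%Ord.
  apply: kmin; split; [exact: one_le_add|exact: Sig_eq_kBor].
case=> [kc|kc]; first by left; apply: ord_lt_le_trans ca1.
case: ca1 => [ca1|ca1]; last by right; apply: ord_iso_trans ca1.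
by left; apply: ord_iso_lt ca1 => //; [exact: ord_iso_sym|exact: ord_iso_refl].
Qed.

End Hierarchy.

Arguments Sig_iso {k X a b} _.
Arguments Pi_iso {k X a b} _.

(** * The ambiguous classes *)

Section Ambiguous.
Variables (k : Ord) (X : topologicalType).
Hypothesis k_ssl : singular_strong_limit k.
Hypothesis X_open : exists2 V, small k V & open `<=` unions_over V (@closed X).
Hypothesis X_hausdorff : hausdorff_space X.
Variable base : set (set X).
Hypotheses (base_basis : basis base) (base_small : emb {U | base U} k).
Variable a : Ord.
Hypothesis a_small : emb a k.
Hypothesis a_lt_ord : (ord_nat 1 + a < kord k X)%Ord.

Local Notation sunions := (small_unions k).
Local Notation Sig := (@Sig k X).
Local Notation Pi := (@Pi k X).

Let lower : set (set X) :=
  [set A | exists2 b : Ord, (b < a)%Ord & (Sig b `|` Pi b) A].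

Let not_closed c : (c <= a)%Ord ->
  (forall A, Sig c A -> Sig c (~` A)) -> sunions (Sig c) `<=` Sig c -> False.
Proof. exact: lt_kord_not_closed. Qed.

Lemma Sig_not_sub_Pi : even_level k X a -> ~ Sig a `<=` Pi a.
Proof. by move=> [aU _] SP; apply: (not_closed (or_intror (ord_iso_refl a))). Qed.

Lemma lower_sub_Delta : lower `<=` Sig a `&` Pi a.
Proof.
move=> A [b ba [SA|PA]]; split.
- exact: Sig_mono SA.
- exact: Sig_sub_Pi SA.
- exact: Pi_sub_Sig PA.
- exact: Pi_mono PA.
Qed.

(** A small union of sets of [Sig c] and of [Pi c] is the union of a set of
   [Sig c] and of one of [Sig (c + 1)]. *)
Lemma Delta_not_lower_succ c : even_level k X c -> ord_iso a (c + ord_nat 1)%Ord ->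
  ~ Sig a `&` Pi a `<=` lower.
Proof.
move=> ec ac Dl; have SP : Sig a = Pi a by rewrite (Sig_iso ac) (Pi_iso ac) Sig_succ_even.
have ca : (c < a)%Ord.
  exact: ord_iso_lt (ord_iso_refl _) (ord_iso_sym ac) (ord_succ_lt c).
have le_c b : (b < a)%Ord -> (b <= c)%Ord.
  by move=> ba; apply: ord_lt_succ; apply: ord_iso_lt (ord_iso_refl _) ac ba.
have SaE : Sig a = Sig c `|` Pi c.
  apply/seteqP; split=> [A SA|A [SA|PA]]; [|exact: Sig_mono SA|exact: Pi_sub_Sig PA].
  have [b /le_c[bc|bc]] : lower A by apply: Dl; split; rewrite -?SP.
    by case=> [SA'|PA']; [left; apply: Sig_mono SA'|right; apply: Pi_mono PA'].
  by rewrite (Sig_iso bc) (Pi_iso bc).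
apply: (not_closed (or_intror (ord_iso_refl a))) => [A|A].
  by rewrite {1}SP.
move=> [J [B [sJ SB ->]]].
pose JS := {j | Sig c (B j)}; pose JP := {j | Pi c (B j)}.
have -> : \bigcup_j B j = \bigcup_(j : JS) B (sval j) `|` \bigcup_(j : JP) B (sval j).
  apply/seteqP; split=> [x [j _ Bx]|x [[j _ Bx]|[j _ Bx]]]; try by exists (sval j).
  have := SB j; rewrite SaE => -[Sj|Pj]; [left|right].
    by exists (exist _ j Sj).
  by exists (exist _ j Pj).
have : Sig (c + ord_nat 1)%Ord = Sig a by rewrite (Sig_iso ac).
rewrite Sig_succ // => <-; apply: small_unionsU => //.
  rewrite -(@Sig_succ k X) //; apply: Sig_mono (ord_succ_lt c) _ _ => //.
  apply: ec.1; apply: small_unions_bigcup => [|j]; last exact: svalP j.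
  exact: small_emb (emb_sub _) sJ.
apply: small_unions_bigcup => [|j]; last exact: svalP j.
exact: small_emb (emb_sub _) sJ.
Qed.

(** The sets of [Sig (c + 1)] are stratified by the number of sets of [Pi c] that
   are needed to exhaust them. *)
Lemma Delta_not_lower_succ2 c : even_level k X c ->
  ord_iso a (c + ord_nat 1 + ord_nat 1)%Ord -> ~ Sig a `&` Pi a `<=` lower.
Proof.
move=> ec ac Dl; set c1 := (c + ord_nat 1)%Ord in ac.
have c1a : (c1 < a)%Ord.
  exact: ord_iso_lt (ord_iso_refl _) (ord_iso_sym ac) (ord_succ_lt c1).
have SP1 : Sig c1 = Pi c1 by apply: Sig_succ_even.
have Sc1 : Sig c1 = sunions (Pi c) by apply: Sig_succ.
have lower_c1 : lower `<=` Sig c1.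
  move=> A [b ba SPA]; have /ord_lt_succ[bc|bc] : (b < c1 + ord_nat 1)%Ord.
  - exact: ord_iso_lt (ord_iso_refl _) ac ba.
  - by case: SPA => [SA|PA]; [apply: Sig_mono SA|apply: Pi_sub_Sig PA].
  by move: SPA; rewrite (Sig_iso bc) (Pi_iso bc) -SP1 => -[].
pose lev (i : k) := unions_over (seg i) (Pi c).
have lev_pad i V : emb V (seg i) -> unions_over V (Pi c) `<=` lev i.
  by move=> Vi; apply: unions_over_emb Vi; apply: Pi_set0.
have algE A : (exists i, lev i A) <-> Sig c1 A.
  rewrite Sc1; split=> [[i]|[J [B [[i Ji] PB ->]]]].
    exact/small_unions_over/small_seg.
  by exists i; apply: lev_pad Ji _ _; exists B.
have lev_setC i : exists j, forall A, lev i A -> lev j (~` A).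
  have [J' [j J'j] J'P] := even_level_setC k_ssl ec (small_seg i).
  by exists j => A lA; apply: lev_pad J'j _ _; apply: J'P.
have lev_bigcup i (T : Type) : small k T -> exists j,
    forall A : T -> set X, (forall t, lev i (A t)) -> lev j (\bigcup_t A t).
  move=> sT; have [j Tj] := small_prod k_ssl sT (small_seg i); exists j => A lA.
  have /choice[B BP] t : exists B : seg i -> set X,
      (forall v, Pi c (B v)) /\ A t = \bigcup_v B v.
    by have [B PB AB] := lA t; exists B.
  apply: (lev_pad _ _ Tj); exists (fun p => B p.1 p.2) => [p|]; first exact: (BP _).1.
  apply/seteqP; split=> [x [t _]|x [[t v] _ Bx]].
    by rewrite (BP t).2 => -[v _ Bx]; exists (t, v).
  by exists t => //; rewrite (BP t).2; exists v.
have lev_open : exists i, open `<=` lev i.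
  have [_ [V [i Vi] VP]] := ec; exists i => U oU; apply: (lev_pad _ _ Vi); apply: VP.
  exact: open_sub_Sig.
have lev_mono i j : ole i j -> lev i `<=` lev j by move=> ij; apply/lev_pad/emb_seg_le.
have I_cof : exists (D : Type) (g : D -> k), small k D /\ cofinal g.
  exact: small_cofinal (nomax_self k_ssl) (emb_refl k).
have amb A : sunions [set A | exists i, lev i A] A ->
    sunions [set A | exists i, lev i A] (~` A) -> exists i, lev i A.
  have sub : sunions [set A | exists i, lev i A] `<=` Sig a.
    rewrite (Sig_iso ac) Sig_succ // -SP1; apply: sub_small_unions => B.
    by move/algE.
  by move=> /sub SA /sub PA; apply/algE/lower_c1/Dl.
have [i stat] := exhaustion_stationary k_ssl X_hausdorff base_basis base_small
  (nomax_self k_ssl) I_cof lev_mono lev_setC lev_bigcup lev_open amb.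
apply: (not_closed (or_introl c1a)) => [A|A [J [B [sJ SB ->]]]].
  by rewrite {1}SP1.
have [j ij] := lev_bigcup i J sJ; apply/algE; exists j; apply: ij => t.
exact/stat/algE.
Qed.

(** At a limit level the sets of the lower levels are stratified by their level. *)
Lemma Delta_not_lower_limit : nomax a -> ~ Sig a `&` Pi a `<=` lower.
Proof.
move=> a_nomax Dl; pose lev (z : a) := Sig (seg z) `&` Pi (seg z).
have next_lev z y : olt z y -> Sig (seg z) `|` Pi (seg z) `<=` lev y.
  move=> /seg_mono zy A [SA|PA]; split.
  - exact: Sig_mono SA.
  - exact: Sig_sub_Pi SA.
  - exact: Pi_sub_Sig PA.
  - exact: Pi_mono PA.
have lev_setC i : exists j, forall A, lev i A -> lev j (~` A).
  by exists i => A [SA PA]; split=> //; apply/PiC.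
have lev_bigcup i (T : Type) : small k T -> exists j,
    forall A : T -> set X, (forall t, lev i (A t)) -> lev j (\bigcup_t A t).
  move=> sT; have [y iy] := a_nomax.2 i; have [y' yy'] := a_nomax.2 y.
  exists y' => A lA; apply: next_lev yy' _ _; left.
  rewrite Sig_inhabited; last by split; exact: in_seg iy.
  apply: small_unions_bigcup => // t; apply: (Pi_below_lt (seg_mono iy)).
  exact: (lA t).2.
have lev_open : exists i, open `<=` lev i.
  have [z0] := a_nomax.1; have [z z0z] := a_nomax.2 z0; exists z => U oU.
  by apply: next_lev z0z _ _; left; apply: open_sub_Sig.
have lev_mono i j : ole i j -> lev i `<=` lev j.
  by move=> /ole_eqVlt[->//|ij] A [SA _]; apply: next_lev ij _ _; left.
have amb A : sunions [set A | exists i, lev i A] A ->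
    sunions [set A | exists i, lev i A] (~` A) -> exists i, lev i A.
  have sub : sunions [set A | exists i, lev i A] `<=` Sig a.
    rewrite Sig_inhabited; last exact: a_nomax.1.
    by apply: sub_small_unions => B [i [_ PB]]; exists i.
  move=> /sub SA /sub PA; have [b /ord_ltP[z bz] SPA] : lower A by apply: Dl.
  have [y zy] := a_nomax.2 z; exists y; apply: next_lev zy _ _.
  by rewrite -(Sig_iso bz) -(Pi_iso bz).
have [i stat] := exhaustion_stationary k_ssl X_hausdorff base_basis base_small
  a_nomax (small_cofinal k_ssl a_nomax a_small) lev_mono lev_setC lev_bigcup lev_open amb.
have [y iy] := a_nomax.2 i.
have Slev A : Sig (seg i) A -> lev i A.
  by move=> SA; apply: stat; exists y; apply: next_lev iy _ _; left.
apply: (not_closed (or_introl (seg_lt i))) => [A /Slev[_]//|A [J [B [sJ SB ->]]]].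
have [j ij] := lev_bigcup i J sJ; apply: (stat _ _).1; exists j; apply: ij => t.
exact: Slev.
Qed.

Lemma Delta_not_lower : ~ Sig a `&` Pi a `<=` lower.
Proof.
have [a0|a_nomax|[z zmax]] := max_or_nomax a.
- move=> Dl; have [|b /ord_lt_nonempty[/a0]//] := Dl set0.
  by split; [apply: open_sub_Sig => //; apply: open0|apply: Pi_set0].
- exact: Delta_not_lower_limit.
have az := ord_max_succ zmax.
have [|ez|[c ec zc]] := even_level_or_succ k_ssl X_open (a := seg z).
- exact: emb_trans (emb_seg z) a_small.
- exact: Delta_not_lower_succ ez az.
apply: (Delta_not_lower_succ2 ec); apply: ord_iso_trans az _.
exact: ord_add_iso zc (ord_iso_refl _).
Qed.

End Ambiguous.

(** If [cof k] were the default value [0] of [ord_min], the hypothesis would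
   make every open set empty. *)
Lemma cof_cofinal (k : Ord) (X : topologicalType) (X_nonempty : [set: X] !=set0)
    (X_open : forall U : set X, open U ->
      exists F : set (set X),
        [/\ F #<= [set: cof k], F `<=` closed & U = \bigcup_(C in F) C]) :
  exists f : cof k -> k, cofinal f.
Proof.
have : inhabited (cof k).
  have [x _] := X_nonempty; have [F [/emb_card_le[e _] _ FX]] := X_open _ openT.
  by have [C FC _] : (\bigcup_(C in F) C) x; [rewrite -FX|have [d _] := e (exist _ C FC)].
rewrite /cof /ord_min; case: pselect => [ex|_ [/ord_nat0_empty]//] _.
exact: (svalP (cid ex)).1.
Qed.

Lemma singular_strong_limitP (k : Ord) : uncountable_singular k ->
  two_pow_lt_eq k -> (exists f : cof k -> k, cofinal f) -> singular_strong_limit k.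
Proof.
move=> [kcard kunc /ord_ltP[w [g gm [h gK hK]]]] kpow [f fcof]; split.
- move=> z kz; apply: (kcard _ (seg_lt z)).
  by rewrite card_eq_le !card_leT_emb //; apply: emb_seg.
- by move=> kn; apply: kunc; apply: card_leT_emb.
- exists w, (f \o h) => x; have [d xd] := fcof x.
  by exists (g d); rewrite /= gK.
by move: kpow; rewrite /two_pow_lt_eq card_eq_le => /andP[/emb_setT].
Qed.

Lemma open_unions_closed (k : Ord) (X : topologicalType)
    (X_open : forall U : set X, open U ->
      exists F : set (set X),
        [/\ F #<= [set: cof k], F `<=` closed & U = \bigcup_(C in F) C]) :
  open `<=` unions_over (cof k) (@closed X).
Proof.
move=> U /X_open[F [/emb_card_le[e ei] Fclosed ->]].
have Fk : emb {C | F C} (cof k).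
  by exists (sval \o e); apply: inj_comp ei; apply: sval_inj.
apply: (@unions_over_emb X _ _ (@closed X) _ Fk); first exact: closed0.
exists sval => [C|].
  by apply: Fclosed; apply: (svalP C).
apply/seteqP; split=> [x [C FC Cx]|x [C _ Cx]]; first by exists (exist _ C FC).
by exists (sval C) => //; apply: (svalP C).
Qed.

Theorem proposition5p5 (k : Ord) (X : topologicalType) (a : Ord)
    (k_singular : uncountable_singular k)
    (k_pow : two_pow_lt_eq k)
    (X_nonempty : [set: X] !=set0)
    (X_regular : regular_space X)
    (X_hausdorff : hausdorff_space X)
    (X_weight : weight_le X k)
    (X_open : forall U : set X, open U ->
      exists F : set (set X),
        [/\ F #<= [set: cof k], F `<=` closed & U = \bigcup_(C in F) C])
    (a_lt_succ : (a < card_succ k)%Ord)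
    (a_lt_ord : (ord_nat 1 + a < kord k X)%Ord) :
  (ord_even a ->
     kDelta k X (ord_nat 1 + a)%Ord `<` kSigma k X (ord_nat 1 + a)%Ord /\
     kDelta k X (ord_nat 1 + a)%Ord `<` kPi k X (ord_nat 1 + a)%Ord)
  /\
  [set A | exists2 b : Ord, (b < a)%Ord &
      (kSigma k X (ord_nat 1 + b)%Ord `|` kPi k X (ord_nat 1 + b)%Ord) A]
    `<` kDelta k X (ord_nat 1 + a)%Ord.
Proof.
have k_ssl : singular_strong_limit k.
  exact: singular_strong_limitP k_singular k_pow (cof_cofinal X_nonempty X_open).
have open_V : exists2 V, small k V & open `<=` unions_over V (@closed X).
  exists (cof k); last exact: open_unions_closed.
  by have [_ _ /small_lt] := k_singular.
have [base base_basis /emb_card_le base_k] := X_weight.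
have base_small : emb {U | base U} k by apply: emb_trans base_k (emb_sub _).
have a_small := lt_card_succ a_lt_succ.
split=> [a_even|]; last first.
  split; [exact: lower_sub_Delta|].
  exact: (Delta_not_lower k_ssl open_V X_hausdorff base_basis base_small a_small).
have nSP : ~ kSigma k X (ord_nat 1 + a)%Ord `<=` kPi k X (ord_nat 1 + a)%Ord.
  apply: (Sig_not_sub_Pi open_V a_lt_ord).
  exact: (even_level_even k_ssl open_V a_small a_even).
split; split; [by move=> A []| |by move=> A []|].
  by move=> SD; apply: nSP => A /SD[].
move=> PD; apply: nSP => A SA; have [|] := PD (~` A) => //.
by rewrite /kPi /= setCK.
Qed.
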